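(* For every integer $n \geq 1$, $\mathrm{C}_{\sharp = n} <_W \mathrm{C}_{\sharp = n+1}$, i.e. $\mathrm{C}_{\sharp = n} \leq_W \mathrm{C}_{\sharp = n+1}$ but $\mathrm{C}_{\sharp = n+1} \nleq_W \mathrm{C}_{\sharp = n}$.
   Context: A represented space is a set $X$ with a partial surjection $\delta_X :\subseteq \mathbb{N}^\mathbb{N} \to X$. A realizer of a multivalued $f :\subseteq X \rightrightarrows Y$ is a partial $F$ on Baire space with $\delta_Y F(p) \in f(\delta_X(p))$ for all $p \in \operatorname{dom}(f\delta_X)$. $f \leq_W g$ iff there are computable partial $K,H$ on Baire space such that $p \mapsto K\langle p, G(H(p))\rangle$ realizes $f$ for every realizer $G$ of $g$. Closed choice $\mathrm{C}_X$ on a space $X$ takes a non-empty closed set (given negatively) and returns any point of it. Closed subsets of Cantor space are named by binary trees (the set of infinite paths); $\mathrm{C}_{\sharp = m}$ is the restriction of $\mathrm{C}_{\{0,1\}^\mathbb{N}}$ to those trees which have exactly $m$ vertices at every level $k$ with $2^k \geq m$ and in which from some finite depth onwards every vertex has exactly one child (so the set has exactly $m$ points). *)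

(* Defs.v *)
From mathcomp Require Import all_boot.
Set Implicit Arguments. Unset Strict Implicit. Unset Printing Implicit Defensive.

Inductive prf : Type :=
| PZero | PSucc | PProj (i : nat)
| PComp (f : prf) (gs : seq prf)
| PRec (f g : prf)
| PMin (f : prf).

Inductive eval : prf -> seq nat -> nat -> Prop :=
| eZero v : eval PZero v 0
| eSucc v : eval PSucc v (nth 0 v 0).+1
| eProj i v : eval (PProj i) v (nth 0 v i)
| eComp f gs v ws y : evals gs v ws -> eval f ws y -> eval (PComp f gs) v y
| eRec0 f g v y : eval f v y -> eval (PRec f g) (0 :: v) y
| eRecS f g n v r y :
    eval (PRec f g) (n :: v) r -> eval g (n :: r :: v) y -> eval (PRec f g) (n.+1 :: v) y
| eMin f v n : eval f (n :: v) 0 ->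
    (forall m, m < n -> exists k, eval f (m :: v) k.+1) -> eval (PMin f) v n
with evals : seq prf -> seq nat -> seq nat -> Prop :=
| esNil v : evals [::] v [::]
| esCons g gs v y ys : eval g v y -> evals gs v ys -> evals (g :: gs) v (y :: ys).

Definition computable_nat (f : nat -> nat) : Prop :=
  exists c : prf, forall n, eval c [:: n] (f n).

Definition baire := nat -> nat.

Definition computable_word_fun (h : seq nat -> seq nat) : Prop :=
  computable_nat (fun n => CodeSeq.code (h (CodeSeq.decode n))).

Definition monotone_word_fun (h : seq nat -> seq nat) : Prop :=
  forall u v, prefix u v -> prefix (h u) (h v).

(* the monotone word function h maps p to q = sup_k h (p|k) *)
Definition word_fun_out (h : seq nat -> seq nat) (p q : baire) : Prop :=
  forall n, exists k, n < size (h (mkseq p k)) /\ nth 0 (h (mkseq p k)) n = q n.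

Record pfun := PFun { pdom : baire -> Prop; pval : baire -> baire }.

(* F is computable: some Type-2 machine (= computable monotone word function)
   computes F(p) from p for every p in dom F *)
Definition computable_pfun (F : pfun) : Prop :=
  exists h, [/\ computable_word_fun h, monotone_word_fun h &
             forall p, pdom F p -> word_fun_out h p (pval F p)].

Definition bpair (p q : baire) : baire :=
  fun n => if odd n then q n./2 else p n./2.

(* delta : relation "p is a name of x" (graph of the partial representation) *)
Record rep_space := RepSpace { rcar : Type; rdelta : baire -> rcar -> Prop }.

(* multivalued partial problem f :⊆ X ⇉ Y given by its graph; dom f = {x | f x nonempty} *)
Definition mproblem (X Y : rep_space) := rcar X -> rcar Y -> Prop.

Definition realizer (X Y : rep_space) (f : mproblem X Y) (F : pfun) : Prop :=
  forall p x, @rdelta X p x -> (exists y, f x y) ->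
    pdom F p /\ exists y, @rdelta Y (pval F p) y /\ f x y.

Definition wcomp (K H G : pfun) : pfun :=
  PFun (fun p => [/\ pdom H p, pdom G (pval H p) & pdom K (bpair p (pval G (pval H p)))])
       (fun p => pval K (bpair p (pval G (pval H p)))).

Definition Weihrauch_le (X Y Z W : rep_space) (f : mproblem X Y) (g : mproblem Z W) : Prop :=
  exists K H, [/\ computable_pfun K, computable_pfun H &
    forall G, realizer g G -> realizer f (wcomp K H G)].

Definition Cantor : rep_space :=
  @RepSpace (nat -> bool) (fun p x => forall n, p n = nat_of_bool (x n)).

(* bijective coding of binary words by naturals *)
Definition bcode (w : seq bool) : nat := foldr (fun (b : bool) (n : nat) => (n.*2 + 1 + nat_of_bool b)%N) 0 w.

Definition Trees : rep_space :=
  @RepSpace (seq bool -> bool) (fun p T => forall w, T w = (p (bcode w) != 0)).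

Definition is_tree (T : seq bool -> bool) : Prop :=
  forall w b, T (rcons w b) -> T w.

Definition level_count (T : seq bool -> bool) (k : nat) : nat :=
  #|[set t : k.-tuple bool | T t]|.

Definition sharp_tree (m : nat) (T : seq bool -> bool) : Prop :=
  [/\ is_tree T,
      forall k, m <= 2 ^ k -> level_count T k = m &
      exists d, forall w, d <= size w -> T w ->
        (T (rcons w false) (+) T (rcons w true))].

Definition is_path (T : seq bool -> bool) (x : nat -> bool) : Prop :=
  forall n, T (mkseq x n).

Definition C_sharp (m : nat) : mproblem Trees Cantor :=
  fun T x => sharp_tree m T /\ is_path T x.

(* Main.v *)
(* C_{#n+1} does not reduce to C_{#n}, for topological reasons.  Start with a
   tree T of n+1 paths.  The reduction turns it into a tree S of n paths, each of
   which is mapped to a path of T, so some path v of T is missed.  By continuity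
   this mapping is decided, up to the level where the paths of T separate, by a
   finite prefix of T.  Beyond that prefix let all vertices of T not on v die
   one after the other while v splits: the new S still has a path, and its image
   leaves v at a vertex which is now dead.

   C_{#n} reduces to C_{#n+1} by duplicating one vertex at each level of T.  The
   copy follows the leftmost vertex; whenever that vertex changes, the old copy
   dies while the new leftmost vertex splits, which keeps the number of vertices
   constant.  The leftmost vertex eventually stabilizes, and then so does its
   copy. *)

Require Import Defs.
From mathcomp Require Import all_boot zify.
From Stdlib Require Import FunctionalExtensionality ClassicalEpsilon.
Set Implicit Arguments. Unset Strict Implicit. Unset Printing Implicit Defensive.

(** * Levels of binary trees *)

(** A reduction must work with every realizer of [C_sharp n], and a realizer may return any path of
    [S]; hence all paths of [S], not just one, have answers in [T]. The pigeonhole compares two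
    levels: one of [S] where it has its [n] vertices and has ceased to branch, and level
    [up_log 2 n.+1] of [T], the least one with room for [n.+1] words and so the first whose size
    [sharp_tree n.+1] prescribes. Since the modified [S] resembles the old one only down to a finite
    level, continuity is needed for sequences that are not paths of the old [S] but follow it far
    enough.

    In the other direction the depth at which [T] stops branching is unknown, so the leftmost vertex
    may change any finite number of times, and every level must meanwhile carry [n.+1] distinct
    words. Spelling [T] at half speed leaves a free position after each bit, where a new copy can be
    marked. Both kinds of words spell a vertex of [T] at the same positions, so an answer is decoded
    without knowing its kind. *)

Fixpoint words (k : nat) : seq (seq bool) :=
  if k is k'.+1 then [seq rcons w b | w <- words k', b <- [:: false; true]]
  else [:: [::]].

Lemma words_S k :
  words k.+1 = [seq rcons w b | w <- words k, b <- [:: false; true]].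
Proof. by []. Qed.

Lemma mem_words k w : (w \in words k) = (size w == k).
Proof.
elim: k w => [|k IH] w; first by case: w.
rewrite words_S; apply/allpairsPdep/eqP => [[u [b [+ _ ->]]]|].
  by rewrite IH size_rcons => /eqP ->.
case/lastP: w => // u b; rewrite size_rcons => -[su].
exists u, b; split=> //; first by rewrite IH su.
by case: b; rewrite !inE.
Qed.

Lemma uniq_words k : uniq (words k).
Proof.
elim: k => // k IH; rewrite words_S; apply: allpairs_uniq => // -[u b] [v c] _ _ /= E.
by have [-> ->] := rcons_inj E.
Qed.

Lemma size_words k : size (words k) = 2 ^ k.
Proof. by elim: k => // k IH; rewrite words_S size_allpairs IH expnS mulnC. Qed.

Definition level (T : seq bool -> bool) (k : nat) : seq (seq bool) :=
  [seq w <- words k | T w].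

Lemma mem_level T k w : (w \in level T k) = (size w == k) && T w.
Proof. by rewrite mem_filter mem_words andbC. Qed.

Lemma uniq_level T k : uniq (level T k).
Proof. exact/filter_uniq/uniq_words. Qed.

Lemma level_countE (T : seq bool -> bool) k s :
  uniq s -> (forall w, (w \in s) = (size w == k) && T w) -> level_count T k = size s.
Proof.
move=> us ms; rewrite /level_count cardE -(size_map val).
apply/perm_size/uniq_perm => //; first by rewrite map_inj_uniq ?enum_uniq //;
  exact: val_inj.
move=> w; rewrite ms; apply/mapP/andP => [[t]|[sw Tw]].
  by rewrite mem_enum inE => Tt ->; rewrite size_tuple eqxx.
by exists (Tuple sw); rewrite // mem_enum inE.
Qed.

Lemma size_level T k : size (level T k) = level_count T k.
Proof. by rewrite (level_countE (uniq_level T k) (mem_level T k)). Qed.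

Lemma tree_take T w k : is_tree T -> T w -> T (take k w).
Proof.
move=> treeT; elim/last_ind: w => // w b IH Twb.
have [|lt] := leqP (size w).+1 k; first by rewrite -(size_rcons w b) => /take_oversize ->.
by rewrite -cats1 takel_cat //; apply: IH; exact: treeT Twb.
Qed.

(** [sharp_tree] leaves the number of vertices open on levels too small for [m] words, so the words
    shorter than [k0] can all be kept. *)
Definition levels_tree (k0 : nat) (W : nat -> seq (seq bool)) (w : seq bool) : bool :=
  (size w < k0) || (w \in W (size w)).

(** It suffices to ask for some child from [d] on: the parent map between two levels of [m] words is
    then onto, hence injective, so the child is unique. *)
Lemma sharp_levels_tree m k0 W :
    (forall k, m <= 2 ^ k -> k0 <= k) ->
    (forall l w, k0 <= l -> w \in W l -> size w = l) ->
    (forall l, k0 <= l -> uniq (W l)) ->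
    (forall l, k0 <= l -> size (W l) = m) ->
    (forall l w b, k0 <= l -> rcons w b \in W l.+1 -> w \in W l) ->
    (exists d, forall l w, d <= l -> w \in W l -> exists b, rcons w b \in W l.+1) ->
  sharp_tree m (levels_tree k0 W).
Proof.
move=> mk sW uW cW parW [d chW]; split.
- move=> w b; rewrite /levels_tree size_rcons => /orP[/ltnW->//|wb].
  by case: leqP => //= ks; exact: parW wb.
- move=> k /mk kk; rewrite -(cW k kk); apply: level_countE; first exact: uW.
  move=> w; apply/idP/andP => [wW|[/eqP sw]]; last first.
    by rewrite /levels_tree sw ltnNge kk.
  by rewrite (sW _ _ kk wW) eqxx /levels_tree (sW _ _ kk wW) wW orbT.
exists (maxn d k0) => w; rewrite geq_max => /andP[dw kw].
rewrite /levels_tree !size_rcons !ltnNge kw (leqW kw) /= => wW.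
have [b wb] := chW _ _ dw wW.
set bel := fun v : seq bool => take (size w) v.
have bel_rcons v c : v \in W (size w) -> bel (rcons v c) = v.
  by move=> /(sW _ _ kw) sv; rewrite /bel -cats1 -sv takel_cat // take_size.
have ub : uniq (map bel (W (size w).+1)).
  apply: (leq_size_uniq (uW _ kw)); last by rewrite size_map !cW ?leqW.
  move=> v vW; have [c vc] := chW _ _ dw vW.
  by apply/mapP; exists (rcons v c); rewrite ?bel_rcons.
have neq : (rcons w false \in W (size w).+1) -> (rcons w true \in W (size w).+1) -> False.
  move=> w0 w1.
  suff /eqP : rcons w false = rcons w true by rewrite eqseq_rcons eqxx.
  have [i0 i1] := (index_mem (rcons w false) (W (size w).+1), index_mem (rcons w true) (W (size w).+1)).
  rewrite -(nth_index [::] w0) -(nth_index [::] w1); congr nth.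
  apply/eqP; rewrite -(nth_uniq [::] _ _ ub) ?size_map ?index_mem //.
  by rewrite !(nth_map [::]) ?index_mem // !nth_index // !bel_rcons.
case: b wb => wb; rewrite wb ?addbT ?addTb.
  by apply/negP => w0; exact: neq.
by apply/negP => w0; exact: neq.
Qed.

Lemma path_through T d w : is_tree T ->
    (forall w, d <= size w -> T w -> T (rcons w false) (+) T (rcons w true)) ->
    d <= size w -> T w ->
  exists2 y, is_path T y & mkseq y (size w) = w.
Proof.
move=> treeT chT dw Tw.
(* The bit [T (rcons v true)] always points to the only child of [v]. *)
pose u j := iter j (fun v => rcons v (T (rcons v true))) w.
have su j : size (u j) = size w + j.
  by elim: j => [|j IH]; rewrite ?addn0 //= size_rcons IH addnS.
have Tu j : T (u j).
  elim: j => //= j IH;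
    have := chT (u j); rewrite su IH => /(_ (leq_trans dw (leq_addr _ _)) isT).
  rewrite /u /=; case E: (T (rcons _ true)) => //; by rewrite addbF.
have nu j k i : i < size w + j -> nth false (u (k + j)) i = nth false (u j) i.
  move=> ij; elim: k => //= k IH.
  rewrite nth_rcons -/(u _) su.
  by have -> : i < size w + (k + j) by lia.
pose y i := nth false (u i.+1) i.
have yE j : mkseq y (size w + j) = u j.
  apply: (@eq_from_nth _ false); rewrite size_mkseq ?su // => i ij.
  rewrite nth_mkseq // /y.
  have [ji|ji] := leqP j i.+1; first by rewrite -(subnK ji) nu // subnK.
  by rewrite -(subnK (ltnW ji)) nu //; lia.
exists y; last by rewrite -[X in mkseq y X]addn0 yE.
move=> n; have -> : mkseq y n = take n (mkseq y (size w + n)).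
  apply: (@eq_from_nth _ false); first by rewrite size_take !size_mkseq; case: ltnP; lia.
  move=> i; rewrite size_mkseq => ik.
  by rewrite nth_take // !nth_mkseq //; lia.
by apply: tree_take => //; rewrite yE.
Qed.

Lemma sharp_tree_path m T : 0 < m -> sharp_tree m T -> exists y, is_path T y.
Proof.
move=> m0 [treeT cT [d chT]].
(* Level [m + d] has room for [m] words and lies beyond the last branching. *)
have mk : m <= 2 ^ (m + d).
  by apply: leq_trans (leq_addr d m) _; exact/ltnW/ltn_expl.
have : 0 < size (level T (m + d)) by rewrite size_level cT.
case: level (mem_level T (m + d)) => // w s /(_ w);
  rewrite mem_head => /esym/andP[/eqP sw Tw] _.
have dw : d <= size w by rewrite sw leq_addl.
by have [y yT _] := path_through treeT chT dw Tw; exists y.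
Qed.

(** * Coding of binary words by numbers *)

Definition bstep (a : seq bool * nat) : seq bool * nat :=
  if a.2 is m.+1 then (rcons a.1 (odd m), m./2) else a.

(** [bcode] is bijective numeration in base 2 with digits 1 and 2, least significant digit first,
    and [bstep] strips one digit. The number 0 is a fixed point and every other number shrinks, so
    [i] steps are enough. *)
Definition bdecode (i : nat) : seq bool := (iter i bstep ([::], i)).1.

Lemma size_bcode w : size w <= bcode w.
Proof. by elim: w => //= b w IH; rewrite -muln2; lia. Qed.

(** Bounds the positions of a name of a tree that speak about vertices of a given length. *)
Lemma bcode_lt w : (bcode w).+1 < 2 ^ (size w).+1.
Proof. by elim: w => //= b w IH; rewrite expnS -/(bcode w) -muln2; case: b; lia. Qed.

Lemma bdecodeK : cancel bcode bdecode.
Proof.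
move=> w; rewrite /bdecode.
suff iterE n acc : size w <= n -> iter n bstep (acc, bcode w) = (acc ++ w, 0).
  by rewrite iterE ?size_bcode.
elim: w n acc => [|b w IH] n acc /=.
  by move=> _; rewrite cats0; elim: n => //= n ->.
case: n => // n; rewrite ltnS iterSr {2}/bstep /= addn1 addSn /= => sw.
rewrite oddD odd_double addFb oddb addnC half_bit_double IH //.
by rewrite cat_rcons.
Qed.

Lemma size_bdecode i : size (bdecode i) <= i.
Proof.
rewrite /bdecode; suff H n acc m : size (iter n bstep (acc, m)).1 <= size acc + n.
  exact: H.
elim: n => [|n IH] /=; first by rewrite addn0.
by rewrite /bstep; case: (iter n _ _) IH => a [|k] //= IH; rewrite ?size_rcons; lia.
Qed.

(** * Realizers and continuity *)

Definition tree_of (q : baire) (w : seq bool) : bool := q (bcode w) != 0.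

Definition tree_name (T : seq bool -> bool) : baire := fun i => T (bdecode i).

Definition cantor_name (y : nat -> bool) : baire := fun n => y n.

Lemma tree_nameP T : rdelta (r := Trees) (tree_name T) T.
Proof. by move=> w; rewrite /tree_name bdecodeK; case: (T w). Qed.

Lemma names_treeE q T : rdelta (r := Trees) q T -> T = tree_of q.
Proof. by move=> qT; apply: functional_extensionality => w; rewrite qT. Qed.

(** The domain consists of the names of solvable instances only, so that a reduction whose query
    falls into it is known to have produced such a name. *)
Lemma choice_realizer n (g : baire -> nat -> bool) :
    (forall q, (exists y, C_sharp n (tree_of q) y) -> C_sharp n (tree_of q) (g q)) ->
  realizer (C_sharp n)
    (PFun (fun q => exists y, C_sharp n (tree_of q) y) (fun q => cantor_name (g q))).
Proof.
move=> gP q T /names_treeE -> ex_y; split=> //=.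
by exists (g q); split=> //; exact: gP.
Qed.

(** The query [q] does not depend on the realizer, whose value at [q] can therefore be replaced by
    any path of the queried tree: [K] has to cope with all of them. *)
Lemma reduction_spec m n K H :
    (forall G, realizer (C_sharp n) G -> realizer (C_sharp m) (wcomp K H G)) ->
  forall T x, C_sharp m T x ->
  let p := tree_name T in
  [/\ pdom H p, sharp_tree n (tree_of (pval H p)) &
    forall y, is_path (tree_of (pval H p)) y ->
      pdom K (bpair p (cantor_name y)) /\
      exists2 x', is_path T x' &
        forall i, pval K (bpair p (cantor_name y)) i = x' i].
Proof.
move=> red T x Tx p; set q := pval H p.
pose g q' := epsilon (inhabits (fun _ : nat => false)) (C_sharp n (tree_of q')).
have gP q' : (exists y, C_sharp n (tree_of q') y) -> C_sharp n (tree_of q') (g q').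
  exact: epsilon_spec.
have ex_x : exists x', C_sharp m T x' by exists x.
have [[Hp [y [shq _]] _] _] := red _ (choice_realizer gP) p T (tree_nameP T) ex_x.
split=> // {}y yq.
(* The realizer [g], altered at the single name [q] to answer [y]. *)
pose gy q' := if excluded_middle_informative (q' = q) then y else g q'.
have gyP q' : (exists y', C_sharp n (tree_of q') y') -> C_sharp n (tree_of q') (gy q').
  by move=> ex_y'; rewrite /gy; case: excluded_middle_informative => [e|_] /=;
    [rewrite e | exact: gP].
have := red _ (choice_realizer gyP) p T (tree_nameP T) ex_x.
have gyq : gy q = y by rewrite /gy; case: excluded_middle_informative.
rewrite /= -/q gyq.
by case=> [[_ _ Kp] [x' [x'E [_ Tx']]]]; split=> //; exists x'.
Qed.

Lemma prefix_nth (u v : seq nat) i : prefix u v -> i < size u -> nth 0 v i = nth 0 u i.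
Proof. by case/prefixP=> s -> iu; rewrite nth_cat iu. Qed.

Lemma prefix_mkseq (p : baire) k l : k <= l -> prefix (mkseq p k) (mkseq p l).
Proof.
move=> kl; apply/prefixP; exists (mkseq (fun i => p (k + i)) (l - k)).
apply: (@eq_from_nth _ 0); rewrite ?size_cat !size_mkseq ?subnKC // => i il.
rewrite nth_cat size_mkseq nth_mkseq //; case: ltnP => ik; rewrite nth_mkseq //; last lia.
by rewrite subnKC.
Qed.

Lemma eq_mkseq_in (X : Type) (f g : nat -> X) k :
  (forall i, i < k -> f i = g i) -> mkseq f k = mkseq g k.
Proof.
by move=> fg; apply/eq_in_map => i; rewrite mem_iota add0n => /andP[_ /fg].
Qed.

Lemma map_mkseq (X Y : Type) (g : X -> Y) (f : nat -> X) k :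
  map g (mkseq f k) = mkseq (g \o f) k.
Proof. by rewrite /mkseq -map_comp. Qed.

(** Each of the first [k] digits is written after a finite prefix of [p], and monotonicity forbids
    revising it on any input that shares this prefix. *)
Lemma word_fun_out_cont h p q k :
    monotone_word_fun h -> word_fun_out h p q ->
  exists M, forall p' q', (forall j, j < M -> p' j = p j) ->
    word_fun_out h p' q' -> forall i, i < k -> q' i = q i.
Proof.
move=> mono pq; elim: k => [|k [M IH]]; first by exists 0.
have [l [hl qk]] := pq k.
exists (maxn M l) => p' q' pp' pq' i; rewrite ltnS leq_eqVlt => /orP[/eqP ->|]; last first.
  by apply: IH pq' i => j jM; apply: pp'; rewrite leq_max jM.
have E : mkseq p l = mkseq p' l.
  by apply: eq_mkseq_in => j jl; rewrite pp' // leq_max jl orbT.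
have [l' [hl' <-]] := pq' k; rewrite -qk E; rewrite E in hl.
case/orP: (leq_total l l') => ll; first by rewrite (prefix_nth (mono _ _ (prefix_mkseq p' ll))).
by rewrite (prefix_nth (mono _ _ (prefix_mkseq p' ll))).
Qed.

(** The length of [ys] is what the pigeonhole counts; the moduli of the finitely many elements are
    merged into their maximum. *)
Lemma seq_uniform_choice (X Y : eqType) (R : X -> Y -> nat -> Prop) (s : seq X) :
    (forall x y M M', M <= M' -> R x y M -> R x y M') ->
    (forall x, x \in s -> exists y M, R x y M) ->
  exists ys M, size ys = size s /\ (forall x, x \in s -> exists2 y, y \in ys & R x y M).
Proof.
move=> monoR; elim: s => [|x s IH] exR; first by exists [::], 0.
have [ys [M [sys ysR]]] := IH (fun z zs => exR z (mem_behead (s := x :: s) zs)).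
have [y [N Rxy]] := exR x (mem_head x s).
exists (y :: ys), (maxn M N); split=> [|z]; first by rewrite /= sys.
rewrite inE => /predU1P[->|/ysR[y' ys' Rz]].
  by exists y; [exact: mem_head | apply: monoR Rxy; exact: leq_maxr].
by exists y'; [exact: mem_behead | apply: monoR Rz; exact: leq_maxl].
Qed.

(** Where [T] no longer branches, staying in [T] forces [y'] to follow [y]. It is applied to a path
    [y'] of another tree, which stays in [T] only down to level [M]. *)
Lemma eq_path_upto (T : seq bool -> bool) d l M y y' :
    (forall w, d <= size w -> T w -> T (rcons w false) (+) T (rcons w true)) ->
    d <= l -> mkseq y l = mkseq y' l -> is_path T y ->
    (forall j, j <= M -> T (mkseq y' j)) ->
  forall j, j < M -> y' j = y j.
Proof.
move=> chT dl E yT y'T; elim/ltn_ind => j IH jM.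
have [jl|lj] := ltnP j l.
  by rewrite -(nth_mkseq false y jl) E nth_mkseq.
have Ej : mkseq y j = mkseq y' j.
  by apply: eq_mkseq_in => i ij; rewrite IH //; exact: ltn_trans jM.
have := chT (mkseq y j); rewrite size_mkseq => /(_ (leq_trans dl lj) (yT j)).
have := y'T j.+1 jM; have := yT j.+1; rewrite !mkseqS -Ej.
by case: (y j); case: (y' j) => // -> ->.
Qed.

(** * C_{#n+1} does not reduce to C_{#n} *)

Section Adversary.

Variable n : nat.

Let k0 := up_log 2 n.+1.

Lemma leq_up_log_pow : n.+1 <= 2 ^ k0.
Proof. exact: up_logP. Qed.

Lemma up_log_pow_min k : n.+1 <= 2 ^ k -> k0 <= k.
Proof. exact: up_log_min. Qed.

Definition vertices : seq (seq bool) := take n.+1 (words k0).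

Lemma size_vertices : size vertices = n.+1.
Proof. by rewrite size_takel // size_words leq_up_log_pow. Qed.

Lemma uniq_vertices : uniq vertices.
Proof. exact/take_uniq/uniq_words. Qed.

Lemma size_vertex a : a < n.+1 -> size (nth [::] vertices a) = k0.
Proof.
move=> an; apply/eqP; rewrite -mem_words; apply: (@mem_take n.+1).
by apply: mem_nth; rewrite size_vertices.
Qed.

(** The default of [nth] continues the vertex by zeros for ever. *)
Definition branch (a : nat) : nat -> bool := nth false (nth [::] vertices a).

Lemma mkseq_branch a : a < n.+1 -> mkseq (branch a) k0 = nth [::] vertices a.
Proof. by move=> an; rewrite -(size_vertex an) mkseq_nth. Qed.

Lemma branch_default a j : a < n.+1 -> k0 <= j -> branch a j = false.
Proof. by move=> an kj; rewrite /branch nth_default // size_vertex. Qed.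

Lemma branch_inj a b : a < n.+1 -> b < n.+1 ->
  (forall j, j < k0 -> branch a j = branch b j) -> a = b.
Proof.
move=> an bn /eq_mkseq_in; rewrite !mkseq_branch // => E.
by apply/eqP; rewrite -(nth_uniq [::] _ _ uniq_vertices) ?size_vertices ?E.
Qed.

(** Think of [n.+1] tokens, one on each vertex of a level. Only the first [l] bits of [tok l a]
    count, so a token may jump to another branch from one level to the next. *)
Definition token_tree (tok : nat -> nat -> nat -> bool) : seq bool -> bool :=
  levels_tree k0 (fun l => [seq mkseq (tok l a) l | a <- iota 0 n.+1]).

Lemma sharp_token_tree (tok : nat -> nat -> nat -> bool) :
    (forall l a b, k0 <= l -> a < n.+1 -> b < n.+1 ->
      (forall j, j < l -> tok l a j = tok l b j) -> a = b) ->
    (forall l a, k0 <= l -> a < n.+1 ->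
      exists2 b, b < n.+1 & forall j, j < l -> tok l.+1 a j = tok l b j) ->
    (exists d, forall l a, d <= l -> a < n.+1 -> tok l.+1 a = tok l a) ->
  sharp_tree n.+1 (token_tree tok).
Proof.
move=> tok_inj tok_par [d tok_st]; apply: sharp_levels_tree.
- exact: up_log_pow_min.
- by move=> l w kl /mapP[a _ ->]; rewrite size_mkseq.
- move=> l kl; rewrite map_inj_in_uniq ?iota_uniq // => a b.
  rewrite !mem_iota /= !add0n => an bn E; apply: tok_inj kl an bn _ => j jl.
  by rewrite -(nth_mkseq false _ jl) E nth_mkseq.
- by move=> l _; rewrite size_map size_iota.
- move=> l w b kl /mapP[a]; rewrite mem_iota => /andP[_ an].
  rewrite mkseqS => /rcons_inj[-> _].
  have [c cn E] := tok_par l a kl an.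
  by apply/mapP; exists c; rewrite ?mem_iota //; exact: eq_mkseq_in.
exists d => l w dl /mapP[a an ->]; exists (tok l a l).
apply/mapP; exists a => //; move: an; rewrite mem_iota => /andP[_ an].
by rewrite tok_st // mkseqS.
Qed.

Definition still_tree := token_tree (fun _ => branch).

Lemma sharp_still_tree : sharp_tree n.+1 still_tree.
Proof.
apply: sharp_token_tree; last by exists 0.
  move=> l a b kl an bn E; apply: branch_inj an bn _ => j jk.
  by apply: E; exact: leq_trans kl.
by move=> l a _ an; exists a.
Qed.

(* At level N + a + 1 the vertex a dies and v splits, the new descendant being
   marked by a bit at position N + a. *)
Definition kill_token (v N l a : nat) : nat -> bool :=
  if (a == v) || (l <= N + a) then branch a
  else fun j => if j < k0 then branch v j else j == N + a.

Definition kill_tree v N := token_tree (kill_token v N).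

Lemma sharp_kill_tree v N : v < n.+1 -> k0 <= N -> sharp_tree n.+1 (kill_tree v N).
Proof.
move=> vn kN; apply: sharp_token_tree.
- move=> l a b kl an bn E.
  (* The first [k0] bits tell which branch a token is on. Tokens that share the branch of [v] are
     told apart by their marks, at positions not below [N], where every [branch] is zero. *)
  have base c j : j < k0 ->
      kill_token v N l c j = branch (if (c == v) || (l <= N + c) then c else v) j.
    by rewrite /kill_token => jk; case: ifP => //; rewrite jk.
  have : (if (a == v) || (l <= N + a) then a else v)
       = (if (b == v) || (l <= N + b) then b else v).
    apply: branch_inj; try by case: ifP.
    by move=> j jk; rewrite -!base // E //; exact: leq_trans kl.
  have far c : (N + c < k0) = false by lia.
  have alive c d : c < n.+1 -> branch c (N + d) = false.
    by move=> cn; rewrite branch_default //; lia.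
  case: ifP => la; case: ifP => lb // ab.
  + have := E (N + b); rewrite /kill_token la lb far alive // eqxx.
    by case/norP: (negbT lb); rewrite -ltnNge => _ -> /(_ isT).
  + have := E (N + a); rewrite /kill_token la lb far alive // eqxx.
    by case/norP: (negbT la); rewrite -ltnNge => _ -> /(_ isT).
  + have := E (N + a); rewrite /kill_token la lb far eqxx.
    case/norP: (negbT la); rewrite -ltnNge => _ -> /(_ isT) /esym/eqP; lia.
- move=> l a kl an; rewrite /kill_token.
  case: ifP => [/orP[/eqP ->|la]|/norP[av]].
  + by exists v; rewrite ?eqxx.
  + by exists a; rewrite // (ltnW la) orbT.
  rewrite -ltnNge ltnS leq_eqVlt => /predU1P[E|la]; last first.
    by exists a; rewrite // (negbTE av) leqNgt la.
  (* Token [a] has just jumped: its mark is at position [N + a = l], the last bit on level [l.+1],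
     so on level [l] it still coincides with the vertex of [v]. *)
  exists v; rewrite // eqxx /= => j jl; case: ifP => // jk.
  by rewrite branch_default ?[k0 <= j]leqNgt ?jk //; apply/negbTE; lia.
exists (N + n.+1) => l a ln an; rewrite /kill_token.
by have [-> ->] : (l.+1 <= N + a) = false /\ (l <= N + a) = false by lia.
Qed.

Lemma kill_tree_prefix v N w : size w <= N -> kill_tree v N w = still_tree w.
Proof.
move=> wN; rewrite /kill_tree /still_tree /token_tree /levels_tree; congr (_ || (_ \in _)).
by apply: eq_map => a; rewrite /kill_token (leq_trans wN (leq_addr _ _)) orbT.
Qed.

(** By level [N + n.+1] all tokens have jumped, so every vertex of that level lies below the vertex
    of [v]. *)
Lemma kill_tree_path v N x : v < n.+1 -> k0 <= N ->
  is_path (kill_tree v N) x -> mkseq x k0 = nth [::] vertices v.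
Proof.
move=> vn kN /(_ (N + n.+1)); rewrite /kill_tree /token_tree /levels_tree size_mkseq.
have -> : (N + n.+1 < k0) = false by lia.
rewrite orFb => /mapP[a]; rewrite mem_iota => /andP[_ an] E.
rewrite -mkseq_branch //; apply: eq_mkseq_in => j jk.
have jl : j < N + n.+1 by lia.
rewrite -(nth_mkseq false x jl) E nth_mkseq // /kill_token.
have -> : (N + n.+1 <= N + a) = false by lia.
by rewrite orbF; case: eqP => [->|] //; rewrite jk.
Qed.

Lemma not_Weihrauch_le_C_sharpS : 0 < n -> ~ Weihrauch_le (C_sharp n.+1) (C_sharp n).
Proof.
move=> n0 [K [H [[hK [_ monoK outK]] [hH [_ monoH outH]]] /reduction_spec red]].
have still_path : exists x, C_sharp n.+1 still_tree x.
  by have [x] := sharp_tree_path (ltn0Sn n) sharp_still_tree; exists x; split;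
    [exact: sharp_still_tree|].
have [x0 /red] := still_path.
set p0 := tree_name still_tree; set S0 := tree_of (pval H p0) => -[Hp0 shS0 KS0].
have [treeS0 cS0 [d chS0]] := shS0.
(* On this level [S0] has exactly [n] vertices and has stopped branching. *)
pose l := n + d.
have lP : n <= 2 ^ l by apply: leq_trans (leq_addr d n) _; exact/ltnW/ltn_expl.
(* Passing through [w] forces the answer to begin with [u], for all inputs that look like [p0] and
   all sequences that stay in [S0] down to level [M]. Nothing else is asked of [p1] and [y1], so
   that the modified tree and a path of its query qualify. *)
pose R (w u : seq bool) M := forall p1 y1, (forall j, j < M -> p1 j = p0 j) ->
  (forall j, j <= M -> S0 (mkseq y1 j)) -> mkseq y1 l = w ->
  pdom K (bpair p1 (cantor_name y1)) ->
  mkseq (pval K (bpair p1 (cantor_name y1))) k0 = map nat_of_bool u.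
have monoR w u M M' : M <= M' -> R w u M -> R w u M'.
  move=> MM RM p1 y1 pp yS; apply: RM => j jM; first by apply: pp; exact: leq_trans MM.
  by apply: yS; exact: leq_trans MM.
have exR w : w \in level S0 l -> exists u M, R w u M.
  rewrite mem_level => /andP[/eqP sw Sw].
  have dw : d <= size w by rewrite sw leq_addl.
  have [y yS yw] := path_through treeS0 chS0 dw Sw.
  have [Kp [x xT xE]] := KS0 y yS.
  have [M MP] := word_fun_out_cont k0 monoK (outK _ Kp).
  exists (mkseq x k0), M => p1 y1 pp y1S y1w Kp1.
  rewrite map_mkseq; apply: eq_mkseq_in => i ik; rewrite (MP _ _ _ (outK _ Kp1)) //=.
  have yy : forall j, j < M -> y1 j = y j.
    apply: eq_path_upto chS0 (leq_addl n d) _ yS y1S.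
    by rewrite y1w -[RHS]yw sw.
  move=> j jM; rewrite /bpair /cantor_name.
  have jM2 : j./2 < M by lia.
  by rewrite pp // yy.
have [us [M [sus MP]]] := seq_uniform_choice monoR exR.
(* Pigeonhole: [us] has as many entries as level [l] of [S0], namely [n], while there are [n.+1]
   vertices. The choice of [v] precedes that of [N]. *)
have [v vn vus] : exists2 v, v < n.+1 & nth [::] vertices v \notin us.
  have /allPn[u /(nthP [::])[v]] : ~~ all (mem us) vertices.
    apply/negP => /allP sub; have := uniq_leq_size uniq_vertices sub.
    by rewrite size_vertices sus size_level cS0 // ltnn.
  by rewrite size_vertices => vn <- ?; exists v.
(* By [bcode_lt], these positions of the query decide all vertices of length at most [maxn l M]. *)
have [M' HM'] := word_fun_out_cont (2 ^ (maxn l M).+1) monoH (outH _ Hp0).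
(* [k0] lets the jumps start only after the branches have separated, [M] hides them from [K], and
   [M'] from the relevant part of the output of [H]. Position [j] of a name concerns a vertex of
   length at most [j], so agreement down to level [N] gives agreement of names below [N]. *)
pose N := maxn k0 (maxn M M').
have kN : k0 <= N by rewrite leq_maxl.
have sh1 := sharp_kill_tree vn kN.
have [x1 x1T] := sharp_tree_path (ltn0Sn n) sh1.
have := red _ x1 (conj sh1 x1T).
set p1 := tree_name _; set S1 := tree_of (pval H p1) => -[Hp1 shS1 KS1].
have pp j : j < N -> p1 j = p0 j.
  by move=> jN; rewrite /p1 /p0 /tree_name kill_tree_prefix //; have := size_bdecode j; lia.
have [y yS] := sharp_tree_path n0 shS1.
have [Kp [x xT xE]] := KS1 y yS.
have yS0 j : j <= maxn l M -> S0 (mkseq y j).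
  move=> jl; have := yS j; rewrite /S1 /S0 /tree_of.
  rewrite (HM' _ _ _ (outH _ Hp1)) //; first by move=> i iM; apply: pp;
    rewrite !leq_max iM !orbT.
  apply: ltn_trans (ltnSn _) (leq_trans (bcode_lt _) _).
  by rewrite size_mkseq leq_pexp2l.
have yl : mkseq y l \in level S0 l by rewrite mem_level size_mkseq eqxx yS0 ?leq_maxl.
have [u uus RM] := MP _ yl.
have : mkseq (pval K (bpair p1 (cantor_name y))) k0 = map nat_of_bool u.
  apply: RM => // j jM; first by apply: pp; rewrite !leq_max jM orbT.
  by apply: yS0; rewrite leq_max jM orbT.
have -> : mkseq (pval K (bpair p1 (cantor_name y))) k0 = map nat_of_bool (mkseq x k0).
  by rewrite map_mkseq; apply: eq_mkseq_in => i _; rewrite xE.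
have inj : injective nat_of_bool by case=> -[].
rewrite (kill_tree_path vn kN xT) => /(inj_map inj) E.
by rewrite E uus in vus.
Qed.

End Adversary.

(** * Duplicating a vertex *)

(** [words] lists children in the order of their parents. If each vertex has exactly one child, the
    first vertex of the next level is thus the child of the first one. *)
Lemma head_level_S (T : seq bool -> bool) k :
    is_tree T ->
    (forall w, size w = k -> T w -> T (rcons w false) (+) T (rcons w true)) ->
    0 < size (level T k) ->
  exists b, head [::] (level T k.+1) = rcons (head [::] (level T k)) b.
Proof.
move=> treeT; rewrite /level words_S.
have : forall w, w \in words k -> size w = k by move=> w; rewrite mem_words => /eqP.
elim: (words k) => //= w ws IH sw chT.
have sws v : v \in ws -> size v = k by move=> vws; apply: sw; rewrite inE vws orbT.
case: ifP => [Tw _|Tw /(IH sws chT)[b E]]; last first.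
  have ch c : T (rcons w c) = false by apply/negP => /treeT; rewrite Tw.
  by exists b; rewrite !ch.
have := chT w (sw w (mem_head _ _)) Tw.
case: ifP => T0 /=; first by exists false.
by move=> ->; exists true.
Qed.

Section Duplication.

Variables (k0 : nat) (T : seq bool -> bool).

(* Past the first k0 bits, even positions spell a vertex of T and odd positions
   are 0; the first k0 bits repeat the beginning of that vertex, so that the
   words are already distinct at level k0. *)
Definition main_bit (x : nat -> bool) (j : nat) : bool :=
  if j < k0 then x j else if odd (j - k0) then false else x (j - k0)./2.

Definition main_word (t : seq bool) (l : nat) : seq bool :=
  mkseq (main_bit (nth false t)) l.

(** Level [k.+1] is the first on which bit [k] of the leftmost vertex is known. The maximum with
    [k0] keeps to levels whose size is prescribed; as a result the leader does not move while
    [k <= k0]. *)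
Definition leader (k : nat) : seq bool := head [::] (level T (maxn k0 k).+1).

(* The extra word follows the leftmost vertex of T one level ahead; it starts
   with k0 bits outside T, and whenever the leftmost vertex is not an extension
   of the previous one, it dies and branches off the main word of the new
   leftmost vertex by a bit 1 at an odd position. *)
Fixpoint extra_word (j : nat) : seq bool :=
  if j is j'.+1 then
    if odd j' then
      if take j'./2.+1 (leader j'./2) == take j'./2.+1 (leader j'./2.+1)
      then rcons (extra_word j') false
      else rcons (main_word (leader j'./2.+1) (k0 + j')) true
    else rcons (extra_word j') (nth false (leader j'./2) j'./2)
  else head [::] [seq w <- words k0 | ~~ T w].

(** A main word of length [l] repeats [k0] bits of its vertex and has spelled [uphalf (l - k0)]
    bits, so it determines the vertex up to the larger of these two lengths. *)
Definition dup_level (l : nat) : seq (seq bool) :=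
  extra_word (l - k0) ::
    [seq main_word t l | t <- level T (maxn k0 (uphalf (l - k0)))].

Definition dup_tree : seq bool -> bool := levels_tree k0 dup_level.

Lemma size_main_word t l : size (main_word t l) = l.
Proof. exact: size_mkseq. Qed.

Lemma nth_main_word t l i : k0 + i.*2 < l ->
  nth false (main_word t l) (k0 + i.*2) = nth false t i.
Proof.
move=> il; rewrite nth_mkseq // /main_bit ltnNge leq_addr /= addKn odd_double.
by rewrite doubleK.
Qed.

Lemma main_word_take M t l : k0 <= M -> uphalf (l - k0) <= M ->
  main_word (take M t) l = main_word t l.
Proof.
move=> kM lM; apply/eq_in_map => j; rewrite mem_iota => /andP[_ jl].
rewrite /main_bit; case: ltnP => jk; first by rewrite nth_take //; lia.
by case: ifP => // ?; rewrite nth_take //; lia.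
Qed.

Lemma main_word_rcons t l :
  main_word t l.+1 = rcons (main_word t l) (main_bit (nth false t) l).
Proof. exact: mkseqS. Qed.

Lemma take_main_word t l : k0 <= l -> k0 <= size t ->
  take k0 (main_word t l) = take k0 t.
Proof.
move=> kl kt; apply: (@eq_from_nth _ false); first by rewrite !size_takel ?size_main_word.
move=> i; rewrite size_takel ?size_main_word // => ik.
by rewrite !nth_take // nth_mkseq ?(leq_trans ik) // /main_bit ik.
Qed.

Section Sharp.

Variables (n : nat) (d : nat).

Hypotheses (n_gt0 : 0 < n) (n_lt : n < 2 ^ k0).
Hypothesis k0_min : forall k, n.+1 <= 2 ^ k -> k0 <= k.
Hypothesis treeT : is_tree T.
Hypothesis countT : forall k, n <= 2 ^ k -> level_count T k = n.
Hypothesis chT : forall w, d <= size w -> T w -> T (rcons w false) (+) T (rcons w true).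

Lemma size_level_sharp k : k0 <= k -> size (level T k) = n.
Proof.
move=> kk; rewrite size_level countT //; apply: leq_trans (ltnW n_lt) _.
by rewrite leq_pexp2l.
Qed.

Lemma leader_level k : leader k \in level T (maxn k0 k).+1.
Proof.
rewrite /leader; have := size_level_sharp (leqW (leq_maxl k0 k)).
by case: level => [|w s] /= E; [move: n_gt0; rewrite -E | exact: mem_head].
Qed.

Lemma size_leader k : size (leader k) = (maxn k0 k).+1.
Proof. by have := leader_level k; rewrite mem_level => /andP[/eqP]. Qed.

Lemma leader_tree k : T (leader k).
Proof. by have := leader_level k; rewrite mem_level => /andP[]. Qed.

Lemma extra_word0 : size (extra_word 0) = k0 /\ ~~ T (extra_word 0).
Proof.
have : has (predC T) (words k0).
  rewrite has_predC; apply/negP => /all_filterP E.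
  have := size_level_sharp (leqnn k0).
  by rewrite /level E size_words => En; move: n_lt; rewrite En ltnn.
rewrite has_filter /=; case: filter (mem_filter (predC T) ^~ (words k0)) => // w s /(_ w).
by rewrite mem_head mem_words /= => /esym/andP[? /eqP].
Qed.

Lemma size_extra_word j : size (extra_word j) = k0 + j.
Proof.
elim: j => [|j IH]; first by rewrite addn0 (proj1 extra_word0).
by rewrite /= ; case: ifP => _;
  [case: ifP => _|]; rewrite size_rcons ?size_main_word ?IH addnS.
Qed.

(** This tells the extra word from all main words. Until the first jump it is the beginning outside
    [T], afterwards a bit 1 where main words have padding; both survive extension. *)
Lemma extra_word_mark j : ~~ T (take k0 (extra_word j)) \/
  exists i, [/\ k0 <= i, odd (i - k0) & nth false (extra_word j) i].
Proof.
have ext w b : k0 <= size w -> (~~ T (take k0 w) \/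
      exists i, [/\ k0 <= i, odd (i - k0) & nth false w i]) ->
    ~~ T (take k0 (rcons w b)) \/
      exists i, [/\ k0 <= i, odd (i - k0) & nth false (rcons w b) i].
  move=> kw [Tw|[i [ki oi wi]]]; first by left; rewrite -cats1 takel_cat.
  right; exists i; split=> //; rewrite nth_rcons ifT //.
  by rewrite ltnNge; apply: contraL wi => iw; rewrite nth_default.
elim: j => [|j IH].
  by left; have [s0] := extra_word0; rewrite -{1}s0 take_size.
have kj : k0 <= size (extra_word j) by rewrite size_extra_word leq_addr.
rewrite /=; case: ifP => oj; [case: ifP => _|]; try exact: ext.
right; exists (k0 + j); split; [exact: leq_addr|by rewrite addKn|].
by rewrite nth_rcons size_main_word ltnn eqxx.
Qed.

Lemma size_dup_level l w : k0 <= l -> w \in dup_level l -> size w = l.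
Proof.
move=> kl; rewrite inE => /predU1P[->|/mapP[t _ ->]]; last exact: size_main_word.
by rewrite size_extra_word subnKC.
Qed.

Lemma uniq_dup_level l : k0 <= l -> uniq (dup_level l).
Proof.
move=> kl; rewrite /= map_inj_in_uniq ?uniq_level ?andbT.
  apply/mapP => -[t]; rewrite mem_level => /andP[/eqP st Tt] E.
  have := extra_word_mark (l - k0); rewrite E => -[|[i [ki oi]]].
    by rewrite take_main_word ?st ?leq_maxl // tree_take.
  have [il|li] := ltnP i l; last by rewrite nth_default // size_main_word.
  by rewrite nth_mkseq // /main_bit ltnNge ki oi.
move=> t t'; rewrite !mem_level => /andP[/eqP st _] /andP[/eqP st' _] E.
apply: (@eq_from_nth _ false) => [|i]; rewrite st ?st' //.
rewrite leq_max => it.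
have [ik|ki] := ltnP i k0.
  have il := leq_trans ik kl.
  have := congr1 (fun w => nth false w i) E.
  by rewrite /main_word !nth_mkseq // /main_bit ik.
have il : k0 + i.*2 < l by lia.
have := congr1 (fun w => nth false w (k0 + i.*2)) E.
by rewrite !nth_main_word.
Qed.

Lemma card_dup_level l : k0 <= l -> size (dup_level l) = n.+1.
Proof. by move=> kl; rewrite /= size_map size_level_sharp // leq_maxl. Qed.

(** [t] may be longer than the level requires: this covers children of vertices and the leaders,
    which run ahead. *)
Lemma main_word_in_level t l : T t -> maxn k0 (uphalf (l - k0)) <= size t ->
  main_word t l \in dup_level l.
Proof.
rewrite geq_max => Tt /andP[kt lt]; rewrite inE; apply/orP; right.
rewrite -(main_word_take t (leq_maxl _ _) (leq_maxr k0 (uphalf (l - k0)))).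
by apply: map_f; rewrite mem_level size_takel ?eqxx ?geq_max ?kt // tree_take.
Qed.

Lemma dup_level_parent l w b : k0 <= l -> rcons w b \in dup_level l.+1 ->
  w \in dup_level l.
Proof.
move=> kl; rewrite inE subSn //= => /predU1P[|/mapP[t]].
  case: ifP => ol; [case: ifP => _|] => /rcons_inj[-> _]; try exact: mem_head.
  rewrite subnKC //; apply: main_word_in_level; first exact: leader_tree.
  by rewrite size_leader; lia.
rewrite mem_level => /andP[/eqP st Tt]; rewrite main_word_rcons => /rcons_inj[-> _].
by apply: main_word_in_level; rewrite // st uphalfE; lia.
Qed.

Lemma leader_stable k : k0 <= k -> d <= k.+1 ->
  take k.+1 (leader k.+1) = leader k.
Proof.
move=> kk dk; have sz : size (leader k) = k.+1 by rewrite size_leader (maxn_idPr kk).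
rewrite /leader (maxn_idPr kk) (maxn_idPr (leqW kk)) in sz *.
have chk w : size w = k.+1 -> T w -> T (rcons w false) (+) T (rcons w true).
  by move=> sw; apply: chT; rewrite sw.
have lk : 0 < size (level T k.+1) by rewrite size_level_sharp // leqW.
have [b ->] := head_level_S treeT chk lk.
by rewrite -cats1 take_size_cat.
Qed.

(** [T] is spelled at half speed from level [k0] on, so beyond this bound at least [k0 + d] bits
    have been spelled. By then the leader only grows and vertices of [T] have exactly one child. *)
Lemma dup_level_child l w : k0 + (k0 + d).*2 < l -> w \in dup_level l ->
  exists b, rcons w b \in dup_level l.+1.
Proof.
move=> ll; have kl : k0 <= l by lia.
rewrite inE => /predU1P[->|/mapP[t + ->]].
  set j := l - k0; suff [b E] : exists b, extra_word j.+1 = rcons (extra_word j) b.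
    by exists b; rewrite inE subSn // -E eqxx.
  rewrite /=; case: ifP => oj; last by eexists.
  rewrite leader_stable ?size_leader ?take_oversize ?eqxx; try lia; first by eexists.
  by rewrite size_leader; lia.
rewrite mem_level => /andP[/eqP st Tt].
(* At odd offsets the next bit is padding and the same vertex [t] serves; at even offsets a child of
   [t] is needed. *)
have [ol|el] := boolP (odd (l - k0)).
  exists (main_bit (nth false t) l); rewrite -main_word_rcons.
  by apply: main_word_in_level; rewrite // st; lia.
have [c Tc] : exists c, T (rcons t c).
  have dt : d <= size t by rewrite st; lia.
  by case E: (T (rcons t true)) (chT dt Tt) => T0;
    [exists true | exists false; rewrite addbF in T0].
exists (main_bit (nth false (rcons t c)) l).
have <- : main_word (rcons t c) l = main_word t l.
  rewrite -(@main_word_take (size t) (rcons t c)) ?st ?leq_maxl ?leq_maxr //.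
  by rewrite -cats1 -st take_size_cat.
rewrite -main_word_rcons; apply: main_word_in_level => //.
by rewrite size_rcons st; lia.
Qed.

Lemma sharp_dup_tree : sharp_tree n.+1 dup_tree.
Proof.
apply: sharp_levels_tree.
- exact: k0_min.
- exact: size_dup_level.
- exact: uniq_dup_level.
- exact: card_dup_level.
- exact: dup_level_parent.
by exists (k0 + (k0 + d).*2).+1 => l w; exact: dup_level_child.
Qed.

(** The invariant behind decoding: at even positions the extra word spells the current leader. When
    the leader changes, either the bits spelled so far agree or the word is replaced. *)
Lemma nth_extra_word j i : i < uphalf j ->
  nth false (extra_word j) (k0 + i.*2) = nth false (leader j./2) i.
Proof.
elim: j => // j IH ij /=; case: ifP => oj; [case: ifP => [/eqP E|_]|].
- have -> : uphalf j = j./2.+1 by lia.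
  rewrite nth_rcons size_extra_word; have -> : k0 + i.*2 < k0 + j by lia.
  rewrite IH; last lia.
  have ij' : i < j./2.+1 by lia.
  by rewrite -(nth_take _ ij') E nth_take.
- have -> : uphalf j = j./2.+1 by lia.
  rewrite nth_rcons size_main_word; have il : k0 + i.*2 < k0 + j by lia.
  by rewrite il nth_main_word.
have -> : uphalf j = j./2 by lia.
rewrite nth_rcons size_extra_word ltn_add2l eqn_add2l.
case: ltngtP => ij2; [by rewrite IH //; lia | lia |].
by have -> : i = j./2 by lia.
Qed.

Lemma dup_tree_path x : is_path dup_tree x -> is_path T (fun i => x (k0 + i.*2)).
Proof.
(* With [k >= k0], the main words of length [k0 + k.*2] spell whole vertices of level [k]. The word
   that [x] follows may change kind with [k], but its even bits lie in [T] each time. *)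
move=> xP m; pose k := maxn m k0; pose l := k0 + k.*2.
suff : T (mkseq (fun i => x (k0 + i.*2)) k).
  move=> /(tree_take m treeT); congr (is_true (T _)).
  apply: (@eq_from_nth _ false); first by rewrite size_takel !size_mkseq // leq_maxl.
  move=> i; rewrite size_takel ?size_mkseq ?leq_maxl // => im.
  by rewrite nth_take // !nth_mkseq // leq_max im.
have xl i : i < k -> x (k0 + i.*2) = nth false (mkseq x l) (k0 + i.*2).
  by move=> ik; rewrite nth_mkseq // ltn_add2l ltn_double.
have := xP l; rewrite /dup_tree /levels_tree size_mkseq ltnNge leq_addr /= /dup_level.
rewrite addKn uphalf_double (maxn_idPr (leq_maxr m k0)) inE => /predU1P[E|/mapP[t]].
  have -> : mkseq (fun i => x (k0 + i.*2)) k = take k (leader k).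
    apply: (@eq_from_nth _ false).
      by rewrite size_mkseq size_takel // size_leader; lia.
    move=> i; rewrite size_mkseq => ik; rewrite nth_mkseq // nth_take // xl // E.
    by rewrite nth_extra_word ?uphalf_double ?doubleK.
  by apply: tree_take; rewrite ?leader_tree.
rewrite mem_level => /andP[/eqP st Tt] E.
have -> // : mkseq (fun i => x (k0 + i.*2)) k = t.
apply: (@eq_from_nth _ false); first by rewrite size_mkseq st.
move=> i; rewrite size_mkseq => ik; rewrite nth_mkseq // xl // E nth_main_word //.
by rewrite ltn_add2l ltn_double.
Qed.

End Sharp.

End Duplication.

Lemma eq_level T T' k : (forall w, size w = k -> T w = T' w) -> level T k = level T' k.
Proof. by move=> TT; apply: eq_in_filter => w; rewrite mem_words => /eqP/TT. Qed.

Lemma eq_extra_word k0 T T' j :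
    (forall w, size w <= k0 + j.+1 -> T w = T' w) ->
  extra_word k0 T j = extra_word k0 T' j.
Proof.
elim: j => [|j IH] TT /=.
  by congr head; apply: eq_in_filter => w; rewrite mem_words => /eqP sw /=;
    rewrite TT // sw addn1.
have lead k : k <= j.+1 -> leader k0 T k = leader k0 T' k.
  by move=> kj; congr head; apply: eq_level => w sw; apply: TT; lia.
rewrite !lead ?IH //; try lia.
by move=> w sw; apply: TT; lia.
Qed.

(** Only one further level of [T] is consulted; hence each digit of the new name depends on a finite
    prefix of the given one. *)
Lemma eq_dup_tree k0 T T' w :
    (forall v, size v <= (size w).+1 -> T v = T' v) ->
  dup_tree k0 T w = dup_tree k0 T' w.
Proof.
move=> TT; rewrite /dup_tree /levels_tree; case: ltnP => //= kw.
congr (_ \in _ :: _); first by apply: eq_extra_word => v sv; apply: TT; lia.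
by congr map; apply: eq_level => v sv; apply: TT; lia.
Qed.

(** * Computable functions on encoded data *)

Lemma eval_comp1 f g v x y : eval g v x -> eval f [:: x] y ->
  eval (PComp f [:: g]) v y.
Proof. by move=> gx fy; apply: eComp fy; do ?constructor. Qed.

Lemma eval_comp2 f g h v x y z : eval g v x -> eval h v y -> eval f [:: x; y] z ->
  eval (PComp f [:: g; h]) v z.
Proof. by move=> gx hy fz; apply: eComp fz; do ?constructor. Qed.

Lemma eval_proj i v x : nth 0 v i = x -> eval (PProj i) v x.
Proof. by move=> <-; constructor. Qed.

Lemma eval_succ x : eval PSucc [:: x] x.+1.
Proof. exact: (eSucc [:: x]). Qed.

Lemma eval_rec f g v (F : nat -> nat) n : eval f v (F 0) ->
    (forall m, m < n -> eval g [:: m, F m & v] (F m.+1)) ->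
  eval (PRec f g) (n :: v) (F n).
Proof.
move=> f0; elim: n => [|n IH] gS; first exact: eRec0.
by apply: eRecS (gS _ _) => //; apply: IH => m mn; apply: gS; exact: ltnW.
Qed.

Lemma eval_min f v (F : nat -> nat) n :
    (forall m, m <= n -> eval f (m :: v) (F m)) -> F n = 0 ->
    (forall m, m < n -> F m != 0) ->
  eval (PMin f) v n.
Proof.
move=> fF Fn Fm; constructor; first by rewrite -Fn; exact: fF.
by move=> m mn; exists (F m).-1; rewrite prednK ?lt0n ?Fm //; exact/fF/ltnW.
Qed.

Definition prf_const n := iter n (fun c => PComp PSucc [:: c]) PZero.

Lemma eval_const n v : eval (prf_const n) v n.
Proof.
by elim: n => [|n IH] /=; [constructor | exact: eval_comp1 IH (eval_succ _)].
Qed.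

Definition prf_add := PRec (PProj 0) (PComp PSucc [:: PProj 1]).

Lemma eval_add a b : eval prf_add [:: a; b] (a + b).
Proof.
apply: (eval_rec (F := addn^~ b)) => [|m _]; first exact: eval_proj.
exact: eval_comp1 (eval_proj _) (eval_succ _).
Qed.

Definition prf_mul := PRec PZero (PComp prf_add [:: PProj 2; PProj 1]).

Lemma eval_mul a b : eval prf_mul [:: a; b] (a * b).
Proof.
apply: (eval_rec (F := muln^~ b)) => [|m _]; first by constructor.
exact: eval_comp2 (eval_proj _) (eval_proj _) (eval_add _ _).
Qed.

Definition prf_pred := PRec PZero (PProj 0).

Lemma eval_pred n : eval prf_pred [:: n] n.-1.
Proof.
by apply: (eval_rec (F := predn)) => [|m _]; [constructor | exact: eval_proj].
Qed.

(** Primitive recursion runs on the first argument, which is therefore the subtrahend. *)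
Definition prf_rsub := PRec (PProj 0) (PComp prf_pred [:: PProj 1]).

Lemma eval_rsub a b : eval prf_rsub [:: a; b] (b - a).
Proof.
apply: (eval_rec (F := subn b)) => [|m _]; first by rewrite subn0; exact: eval_proj.
by rewrite subnS; exact: eval_comp1 (eval_proj _) (eval_pred _).
Qed.

(** Both truncated differences together vanish only for equal arguments, which turns equality into a
    test for zero. *)
Definition prf_dist :=
  PComp prf_add [:: prf_rsub; PComp prf_rsub [:: PProj 1; PProj 0]].

Lemma eval_dist a b : eval prf_dist [:: a; b] ((b - a) + (a - b)).
Proof.
apply: eval_comp2 (eval_rsub _ _) _ (eval_add _ _).
exact: eval_comp2 (eval_proj _) (eval_proj _) (eval_rsub _ _).
Qed.

Definition prf_is0 := PRec (prf_const 1) PZero.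

Lemma eval_is0 n : eval prf_is0 [:: n] (n == 0).
Proof.
apply: (eval_rec (F := fun n => n == 0)) => [|m _]; first exact: eval_const.
by constructor.
Qed.

Definition prf_pow2 := PRec (prf_const 1) (PComp prf_add [:: PProj 1; PProj 1]).

Lemma eval_pow2 n : eval prf_pow2 [:: n] (2 ^ n).
Proof.
apply: (eval_rec (F := expn 2)) => [|m _]; first exact: eval_const.
by rewrite expnS mul2n -addnn; exact: eval_comp2 (eval_proj _) (eval_proj _) (eval_add _ _).
Qed.

(** This is the step of [CodeSeq.code], so that folding it over a list of numbers gives the code
    used in [computable_word_fun]. It is never 0, which is left for the empty list. *)
Definition pair_code (a b : nat) : nat := 2 ^ a * b.*2.+1.

Definition prf_pair :=
  PComp prf_mul [:: PComp prf_pow2 [:: PProj 0];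
                    PComp PSucc [:: PComp prf_add [:: PProj 1; PProj 1]]].

Lemma eval_pair a b : eval prf_pair [:: a; b] (pair_code a b).
Proof.
apply: eval_comp2 (eval_mul _ _); first exact: eval_comp1 (eval_proj _) (eval_pow2 _).
apply: eval_comp1 (eval_succ _); rewrite -addnn.
exact: eval_comp2 (eval_proj _) (eval_proj _) (eval_add _ _).
Qed.

(** Searching for an inequality instead of an equality always terminates, also for the wrong
    candidates [a] that [prf_fst] tries. *)
Definition prf_pair_quo :=
  PMin (PComp prf_rsub [:: PComp prf_pair [:: PProj 1; PProj 0]; PProj 2]).

Lemma pair_code_gt a b : b < pair_code a b.
Proof. by rewrite /pair_code; have := expn_gt0 2 a; case: (2 ^ a) => // k _; lia. Qed.

Lemma pair_code_gt0 a b : 0 < pair_code a b.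
Proof. exact: leq_ltn_trans (pair_code_gt a b). Qed.

Lemma leq_pair_code a b c : (pair_code a b <= pair_code a c) = (b <= c).
Proof. by rewrite leq_pmul2l ?expn_gt0 // ltnS leq_double. Qed.

Definition pair_quo a n := find (fun q => n <= pair_code a q) (iota 0 n.+1).

Lemma pair_quo_leq a n : n <= pair_code a (pair_quo a n).
Proof.
have h : has (fun q => n <= pair_code a q) (iota 0 n.+1).
  by apply/hasP; exists n; rewrite ?mem_iota ?leqnn //; exact/ltnW/pair_code_gt.
by have := nth_find 0 h; rewrite nth_iota // -[X in _ < X](size_iota 0) -has_find.
Qed.

Lemma pair_quo_gt a n q : q < pair_quo a n -> pair_code a q < n.
Proof.
move=> qn; rewrite ltnNge; apply/negP => H.
have := before_find 0 qn; rewrite nth_iota ?H //.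
by rewrite (leq_trans qn) // -[X in _ <= X](size_iota 0) find_size.
Qed.

Lemma eval_pair_quo a n : eval prf_pair_quo [:: a; n] (pair_quo a n).
Proof.
apply: (eval_min (F := fun q => n - pair_code a q)).
- move=> q _; apply: eval_comp2 (eval_rsub _ _); last exact: eval_proj.
  exact: eval_comp2 (eval_proj _) (eval_proj _) (eval_pair _ _).
- by apply/eqP; rewrite subn_eq0 pair_quo_leq.
by move=> q /pair_quo_gt; rewrite subn_eq0 -ltnNge.
Qed.

Lemma pair_quoK a b : pair_quo a (pair_code a b) = b.
Proof.
apply/eqP; rewrite eqn_leq; apply/andP; split; last by rewrite -(leq_pair_code a) pair_quo_leq.
by rewrite leqNgt; apply/negP => /pair_quo_gt; rewrite ltnn.
Qed.

Definition prf_fst :=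
  PMin (PComp prf_dist [:: PComp prf_pair [:: PProj 0; prf_pair_quo]; PProj 1]).

(** After division by [2 ^ a] one side is odd and the other even. The search of [prf_fst] therefore
    cannot stop too early. *)
Lemma pair_code_neq a b c d : a < c -> pair_code a b != pair_code c d.
Proof.
move=> ac; apply/negP; rewrite /pair_code -(subnK (ltnW ac)) addnC expnD -mulnA.
rewrite eqn_pmul2l ?expn_gt0 // => /eqP /(congr1 odd).
by rewrite oddM oddX /= odd_double subn_eq0 leqNgt ac.
Qed.

Lemma eval_fst a b : eval prf_fst [:: pair_code a b] a.
Proof.
set n := pair_code a b.
apply: (eval_min (F := fun x => (n - pair_code x (pair_quo x n)) + (pair_code x (pair_quo x n) - n))).
- move=> x _; apply: eval_comp2 (eval_dist _ _); last exact: eval_proj.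
  by apply: eval_comp2 (eval_pair _ _); [exact: eval_proj | exact: eval_pair_quo].
- by rewrite pair_quoK subnn.
move=> x xa; have := pair_code_neq (pair_quo x n) b xa; rewrite -/n; lia.
Qed.

Definition prf_snd := PComp prf_pair_quo [:: prf_fst; PProj 0].

Lemma eval_snd a b : eval prf_snd [:: pair_code a b] b.
Proof.
by apply: eval_comp2 (eval_fst _ _) (eval_proj _) _ => //; rewrite -{2}(pair_quoK a b);
  exact: eval_pair_quo.
Qed.

Lemma pair_code_inj a b c d : pair_code a b = pair_code c d -> a = c /\ b = d.
Proof.
move=> E; have ac : a = c.
  case: (ltngtP a c) => // lt.
    by have := pair_code_neq b d lt; rewrite E eqxx.
  by have := pair_code_neq d b lt; rewrite E eqxx.
by subst c; split=> //; have := pair_quoK a b; rewrite E pair_quoK.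
Qed.

(** Branching as a recursion of length 0 or 1: [g] is evaluated in both cases, [f] only if the test
    yields 1. *)
Definition prf_if c f g := PComp (PRec g (PComp f [:: PProj 2])) [:: c; PProj 0].

Lemma eval_if_true c f g x y z :
  eval c [:: x] 1 -> eval g [:: x] z -> eval f [:: x] y ->
  eval (prf_if c f g) [:: x] y.
Proof.
move=> cx gz fy; apply: eval_comp2 cx (eval_proj _) _ => //=; apply: eRecS; first exact: eRec0 gz.
exact: eval_comp1 (eval_proj _) fy.
Qed.

Lemma eval_if_false c f g x z :
  eval c [:: x] 0 -> eval g [:: x] z -> eval (prf_if c f g) [:: x] z.
Proof. by move=> cx gz; apply: eval_comp2 cx (eval_proj _) _ => //=; exact: eRec0. Qed.

(** * Computability on encoded types *)

Class encoding (A : Type) := Encoding { enc : A -> nat; enc_inj : injective enc }.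

#[local] Instance enc_nat : encoding nat := @Encoding nat id (@inj_id nat).

#[local] Instance enc_bool : encoding bool.
Proof. by exists nat_of_bool => -[] []. Defined.

#[local] Instance enc_prod A B (EA : encoding A) (EB : encoding B) : encoding (A * B).
Proof.
exists (fun p => pair_code (enc p.1) (enc p.2)).
by move=> [a b] [a' b'] /= /pair_code_inj[aa bb]; rewrite (enc_inj aa) (enc_inj bb).
Defined.

#[local] Instance enc_seq A (EA : encoding A) : encoding (seq A).
Proof.
exists (foldr (fun a n => pair_code (enc a) n) 0).
elim=> [|a s IH] [|b t] //=.
- by move=> /esym/eqP; rewrite (gtn_eqF (pair_code_gt0 _ _)).
- by move=> /eqP; rewrite (gtn_eqF (pair_code_gt0 _ _)).
by move=> /pair_code_inj[ab st]; rewrite (enc_inj ab) (IH _ st).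
Defined.

(** In the rules below, [G] is an environment: variables bound by a recursion or a fold are paired
    to it, so functions of one argument suffice. *)
Definition comput A B {EA : encoding A} {EB : encoding B} (f : A -> B) : Prop :=
  exists c, forall a, eval c [:: enc a] (enc (f a)).

Section Closure.

Context {G A B : Type} {EG : encoding G} {EA : encoding A} {EB : encoding B}.

Lemma eq_comput (f g : G -> A) : f =1 g -> comput f -> comput g.
Proof. by move=> fg [c fc]; exists c => a; rewrite -fg. Qed.

Lemma comput_id : comput (fun x : G => x).
Proof. by exists (PProj 0) => a; exact: eval_proj. Qed.

Lemma comput_const (a : A) : comput (fun _ : G => a).
Proof. by exists (prf_const (enc a)) => x; exact: eval_const. Qed.

Lemma comput_app (h : A -> B) (f : G -> A) :
  comput h -> comput f -> comput (fun x => h (f x)).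
Proof.
by move=> [c hc] [d fd]; exists (PComp c [:: d]) => x;
  exact: eval_comp1 (fd x) (hc _).
Qed.

Lemma comput_pair (f : G -> A) (g : G -> B) :
  comput f -> comput g -> comput (fun x => (f x, g x)).
Proof.
by move=> [c fc] [d gd]; exists (PComp prf_pair [:: c; d]) => x;
  exact: eval_comp2 (fc x) (gd x) (eval_pair _ _).
Qed.

Lemma comput_fst (f : G -> A * B) : comput f -> comput (fun x => (f x).1).
Proof.
by case=> c fc; exists (PComp prf_fst [:: c]) => x;
  exact: eval_comp1 (fc x) (eval_fst _ _).
Qed.

Lemma comput_snd (f : G -> A * B) : comput f -> comput (fun x => (f x).2).
Proof.
by case=> c fc; exists (PComp prf_snd [:: c]) => x;
  exact: eval_comp1 (fc x) (eval_snd _ _).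
Qed.

Lemma comput_succ (f : G -> nat) : comput f -> comput (fun x => (f x).+1).
Proof.
by case=> c fc; exists (PComp PSucc [:: c]) => x;
  exact: eval_comp1 (fc x) (eval_succ _).
Qed.

Lemma comput_enc (f : G -> A) : comput f -> comput (fun x => enc (f x)).
Proof. by []. Qed.

Lemma comput_rec (n : G -> nat) (z : G -> A) (s : G -> nat -> A -> A) :
    comput n -> comput z -> comput (fun q : G * (nat * A) => s q.1 q.2.1 q.2.2) ->
  comput (fun x => nat_rect (fun _ => A) (z x) (s x) (n x)).
Proof.
move=> [cn nP] [cz zP] [cs sP].
exists (PComp (PRec cz (PComp cs [:: PComp prf_pair [:: PProj 2; PComp prf_pair [:: PProj 0; PProj 1]]]))
          [:: cn; PProj 0]) => x.
apply: eval_comp2 (nP x) (eval_proj _) _ => //=.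
apply: (eval_rec (F := fun n => enc (nat_rect (fun _ => A) (z x) (s x) n))) => [|m _]; first exact: zP.
apply: (eval_comp1 _ (sP (x, (m, nat_rect (fun _ => A) (z x) (s x) m)))).
apply: eval_comp2 (eval_proj _) _ (eval_pair _ _) => //.
exact: eval_comp2 (eval_proj _) (eval_proj _) (eval_pair _ _).
Qed.

Lemma comput_if (b : G -> bool) (f g : G -> A) :
  comput b -> comput f -> comput g -> comput (fun x => if b x then f x else g x).
Proof.
move=> [cb bP] [cf fP] [cg gP]; exists (prf_if cb cf cg) => x.
have := bP x; case: (b x) => cx; first exact: eval_if_true cx (gP x) (fP x).
exact: eval_if_false.
Qed.

Lemma comput_eq (f g : G -> A) (e : G -> bool) :
    (forall x, reflect (f x = g x) (e x)) -> comput f -> comput g -> comput e.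
Proof.
move=> eP [cf fP] [cg gP]; exists (PComp prf_is0 [:: PComp prf_dist [:: cf; cg]]) => x.
have -> : e x = (enc (g x) - enc (f x) + (enc (f x) - enc (g x)) == 0).
  apply/eP/eqP => [->|H]; first by rewrite subnn.
  by apply: enc_inj; lia.
exact: eval_comp1 (eval_comp2 (fP x) (gP x) (eval_dist _ _)) (eval_is0 _).
Qed.

Lemma comput_cons (f : G -> A) (g : G -> seq A) :
  comput f -> comput g -> comput (fun x => f x :: g x).
Proof.
by move=> [c fc] [d gd]; exists (PComp prf_pair [:: c; d]) => x;
  exact: eval_comp2 (fc x) (gd x) (eval_pair _ _).
Qed.

Lemma comput_uncons (l : G -> seq A) (z : G -> B) (s : G -> A -> seq A -> B) :
    comput l -> comput z -> comput (fun q : G * (A * seq A) => s q.1 q.2.1 q.2.2) ->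
  comput (fun x => if l x is a :: t then s x a t else z x).
Proof.
move=> [cl lP] [cz zP] [cs sP].
(* prf_if evaluates its second argument only when the list is not empty: prf_fst
   and prf_snd diverge on 0. *)
exists (prf_if (PComp prf_is0 [:: PComp prf_is0 [:: cl]])
   (PComp cs [:: PComp prf_pair [:: PProj 0; cl]]) cz) => x.
have := lP x; case: (l x) => [|a t] clx.
  apply: eval_if_false (zP x); apply: eval_comp1 (eval_is0 1).
  exact: eval_comp1 clx (eval_is0 0).
apply: eval_if_true (zP x) _.
  apply: eval_comp1 (eval_is0 0); apply: eval_comp1 clx _ => /=.
  have E : (enc (a :: t) == 0) = false by exact: gtn_eqF (pair_code_gt0 _ _).
  have : eval prf_is0 [:: enc (a :: t)] (enc (a :: t) == 0) by exact: eval_is0.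
  by rewrite E.
apply: (eval_comp1 _ (sP (x, (a, t)))).
exact: eval_comp2 (eval_proj _) clx (eval_pair _ _).
Qed.

End Closure.

Section Lists.

Context {G A B : Type} {EG : encoding G} {EA : encoding A} {EB : encoding B}.

Lemma size_leq_enc (s : seq A) : size s <= enc s.
Proof.
by elim: s => //= a s IH; apply: leq_ltn_trans IH (pair_code_gt _ _).
Qed.

Lemma comput_foldl (f : G -> B -> A -> B) (z : G -> B) (l : G -> seq A) :
    comput l -> comput z -> comput (fun q : G * (B * A) => f q.1 q.2.1 q.2.2) ->
  comput (fun x => foldl (f x) (z x) (l x)).
Proof.
move=> lP zP fP.
pose step x (p : B * seq A) := if p.2 is a :: t then (f x p.1 a, t) else p.
(* The code of a list bounds its length, so [enc (l x)] steps exhaust it; surplus steps change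
   nothing. *)
pose F x := (nat_rect (fun _ => (B * seq A)%type) (z x, l x) (fun _ => step x) (@enc _ (enc_seq EA) (l x))).1.
apply: (@eq_comput _ _ _ _ F) => [x|].
  suff H n s b : size s <= n ->
    (nat_rect (fun _ => (B * seq A)%type) (b, s) (fun _ => step x) n) = (foldl (f x) b s, [::]).
    by rewrite /F H // size_leq_enc.
  have E k p : nat_rect (fun _ => (B * seq A)%type) p (fun _ => step x) k = iter k (step x) p.
    by elim: k => //= k ->.
  rewrite E; elim: n s b => [|n IH] [|a s] b //= sn.
    by rewrite -iterS iterSr /= (IH [::]).
  by rewrite -iterS iterSr /= IH.
apply: comput_fst; apply: comput_rec; [exact: comput_enc | exact: comput_pair |].
apply: (comput_uncons (l := fun q : G * (nat * (B * seq A)) => q.2.2.2)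
  (z := fun q => q.2.2) (s := fun q a t => (f q.1 q.2.2.1 a, t))).
- by do !apply: comput_snd; exact: comput_id.
- by do !apply: comput_snd; exact: comput_id.
apply: comput_pair; last by do !apply: comput_snd; exact: comput_id.
apply: (comput_app (h := fun q : G * (B * A) => f q.1 q.2.1 q.2.2)
  (f := fun q : (G * (nat * (B * seq A))) * (A * seq A) => (q.1.1, (q.1.2.2.1, q.2.1)))) => //.
apply: comput_pair; first by do !apply: comput_fst; exact: comput_id.
apply: comput_pair; first by apply: comput_fst; do 2!apply: comput_snd; apply: comput_fst;
  exact: comput_id.
by apply: comput_fst; apply: comput_snd; exact: comput_id.
Qed.

End Lists.

Ltac comput_var := solve [repeat first [exact: comput_id | apply: comput_fst | apply: comput_snd]].

Ltac comput_base :=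
  first [comput_var | exact: comput_const | assumption].

Lemma comput_natcase {G A} {EG : encoding G} {EA : encoding A}
    (n : G -> nat) (z : G -> A) (s : G -> nat -> A) :
    comput n -> comput z -> comput (fun q : G * nat => s q.1 q.2) ->
  comput (fun x => if n x is k.+1 then s x k else z x).
Proof.
move=> nP zP sP.
apply: (@eq_comput _ _ _ _ (fun x => nat_rect (fun _ => A) (z x) (fun k _ => s x k) (n x))).
  by move=> x; case: (n x).
apply: comput_rec => //.
apply: (comput_app (h := fun q : G * nat => s q.1 q.2)
  (f := fun q : G * (nat * A) => (q.1, q.2.1))) => //.
by apply: comput_pair; comput_var.
Qed.

Lemma comput_iter {G A} {EG : encoding G} {EA : encoding A}
    (n : G -> nat) (z : G -> A) (s : G -> A -> A) :
    comput n -> comput z -> comput (fun q : G * A => s q.1 q.2) ->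
  comput (fun x => iter (n x) (s x) (z x)).
Proof.
move=> nP zP sP.
apply: (@eq_comput _ _ _ _ (fun x => nat_rect (fun _ => A) (z x) (fun _ => s x) (n x))).
  by move=> x; elim: (n x) => //= k ->.
apply: comput_rec => //.
apply: (comput_app (h := fun q : G * A => s q.1 q.2)
  (f := fun q : G * (nat * A) => (q.1, q.2.2))) => //.
by apply: comput_pair; comput_var.
Qed.

Lemma comput_add {G} {EG : encoding G} (m n : G -> nat) :
  comput m -> comput n -> comput (fun x => m x + n x).
Proof.
move=> mP nP; apply: (@eq_comput _ _ _ _ (fun x => iter (m x) succn (n x))) => [x|].
  by rewrite iter_succn addnC.
by apply: comput_iter => //; apply: comput_succ; comput_var.
Qed.

Lemma comput_pred {G} {EG : encoding G} (n : G -> nat) :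
  comput n -> comput (fun x => (n x).-1).
Proof.
move=> nP; apply: (@eq_comput _ _ _ _ (fun x => if n x is k.+1 then k else 0)).
  by move=> x; case: (n x).
by apply: comput_natcase; comput_base.
Qed.

Lemma comput_sub {G} {EG : encoding G} (m n : G -> nat) :
  comput m -> comput n -> comput (fun x => m x - n x).
Proof.
move=> mP nP; apply: (@eq_comput _ _ _ _ (fun x => iter (n x) predn (m x))) => [x|].
  by elim: (n x) => [|k IH]; rewrite ?subn0 //= IH subnS.
by apply: comput_iter => //; apply: comput_pred; comput_var.
Qed.

Lemma comput_leq {G} {EG : encoding G} (m n : G -> nat) :
  comput m -> comput n -> comput (fun x => m x <= n x).
Proof.
move=> mP nP; apply: (comput_eq (f := fun x => m x - n x) (g := fun _ => 0)).
- by move=> x; apply: eqP.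
- exact: comput_sub.
- exact: comput_const.
Qed.

Lemma comput_neq0 {G} {EG : encoding G} (n : G -> nat) :
  comput n -> comput (fun x => n x != 0).
Proof.
move=> nP; apply: (@eq_comput _ _ _ _ (fun x => 1 <= n x)).
  by move=> x; rewrite lt0n.
by apply: comput_leq; comput_base.
Qed.

Lemma comput_negb {G} {EG : encoding G} (b : G -> bool) :
  comput b -> comput (fun x => ~~ b x).
Proof.
move=> bP; apply: (@eq_comput _ _ _ _ (fun x => if b x then false else true)) => //.
by apply: comput_if; comput_base.
Qed.

Lemma comput_orb {G} {EG : encoding G} (a b : G -> bool) :
  comput a -> comput b -> comput (fun x => a x || b x).
Proof.
move=> aP bP; apply: (@eq_comput _ _ _ _ (fun x => if a x then true else b x)) => //.
by apply: comput_if; comput_base.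
Qed.

Lemma comput_nat_of_bool {G} {EG : encoding G} (b : G -> bool) :
  comput b -> comput (fun x => nat_of_bool (b x)).
Proof. by []. Qed.

Lemma comput_double {G} {EG : encoding G} (n : G -> nat) :
  comput n -> comput (fun x => (n x).*2).
Proof.
move=> nP; apply: (@eq_comput _ _ _ _ (fun x => n x + n x)) => [x|].
  by rewrite addnn.
exact: comput_add.
Qed.

Lemma comput_maxn {G} {EG : encoding G} (m n : G -> nat) :
  comput m -> comput n -> comput (fun x => maxn (m x) (n x)).
Proof.
move=> mP nP; apply: (@eq_comput _ _ _ _ (fun x => m x + (n x - m x))) => [x|].
  by rewrite maxnE.
by apply: comput_add => //; exact: comput_sub.
Qed.

Lemma comput_pow2 {G} {EG : encoding G} (n : G -> nat) :
  comput n -> comput (fun x => 2 ^ n x).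
Proof.
move=> nP; apply: (@eq_comput _ _ _ _ (fun x => iter (n x) double 1)) => [x|].
  by elim: (n x) => //= k ->; rewrite expnS mul2n.
by apply: comput_iter; [comput_base | comput_base | apply: comput_double; comput_var].
Qed.

Lemma comput_odd {G} {EG : encoding G} (n : G -> nat) :
  comput n -> comput (fun x => odd (n x)).
Proof.
move=> nP; apply: (@eq_comput _ _ _ _ (fun x => iter (n x) negb false)) => [x|].
  by elim: (n x) => //= k ->.
by apply: comput_iter; [comput_base | comput_base | apply: comput_negb; comput_var].
Qed.

Lemma comput_half {G} {EG : encoding G} (n : G -> nat) :
  comput n -> comput (fun x => (n x)./2).
Proof.
move=> nP.
apply: (@eq_comput _ _ _ _ (fun x => nat_rect (fun _ => nat) 0 (fun k r => odd k + r) (n x))).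
  by move=> x; elim: (n x) => //= k ->; rewrite uphalf_half.
apply: comput_rec; [comput_base | comput_base |].
by apply: comput_add; [apply: comput_nat_of_bool; apply: comput_odd |]; comput_var.
Qed.

Lemma comput_uphalf {G} {EG : encoding G} (n : G -> nat) :
  comput n -> comput (fun x => uphalf (n x)).
Proof.
move=> nP; apply: (@eq_comput _ _ _ _ (fun x => (n x).+1./2)) => //.
by apply: comput_half; exact: comput_succ.
Qed.

Lemma comput_foldr {G A B} {EG : encoding G} {EA : encoding A} {EB : encoding B}
    (f : G -> A -> B -> B) (z : G -> B) (l : G -> seq A) :
    comput l -> comput z -> comput (fun q : G * (A * B) => f q.1 q.2.1 q.2.2) ->
  comput (fun x => foldr (f x) (z x) (l x)).
Proof.
move=> lP zP fP.
apply: (@eq_comput _ _ _ _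
  (fun x => foldl (fun b a => f x a b) (z x) (foldl (fun s a => a :: s) [::] (l x)))) => [x|].
  have -> s : foldl (fun t (a : A) => a :: t) [::] s = rev s.
    by rewrite -[s in LHS]revK foldl_rev; elim: (rev s) => //= a t ->.
  by rewrite foldl_rev.
apply: comput_foldl => //.
  apply: comput_foldl; [by []|comput_base|].
  by apply: comput_cons; comput_var.
apply: (comput_app (h := fun q : G * (A * B) => f q.1 q.2.1 q.2.2)
  (f := fun q : G * (B * A) => (q.1, (q.2.2, q.2.1)))) => //.
by do 2?[apply: comput_pair]; comput_var.
Qed.

Lemma comput_rcons {G A} {EG : encoding G} {EA : encoding A}
    (s : G -> seq A) (f : G -> A) :
  comput s -> comput f -> comput (fun x => rcons (s x) (f x)).
Proof.
move=> sP fP; apply: (@eq_comput _ _ _ _ (fun x => foldr cons [:: f x] (s x))) => [x|].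
  by elim: (s x) => //= a t ->.
apply: comput_foldr => //; first by apply: comput_cons; comput_base.
by apply: comput_cons; comput_var.
Qed.

Lemma comput_size {G A} {EG : encoding G} {EA : encoding A} (s : G -> seq A) :
  comput s -> comput (fun x => size (s x)).
Proof.
move=> sP; apply: (@eq_comput _ _ _ _ (fun x => foldr (fun _ => succn) 0 (s x))) => [x|].
  by elim: (s x) => //= a t ->.
by apply: comput_foldr; [comput_base | comput_base | apply: comput_succ; comput_var].
Qed.

Lemma comput_head {G A} {EG : encoding G} {EA : encoding A} (s : G -> seq A) (d : A) :
  comput s -> comput (fun x => head d (s x)).
Proof.
by move=> sP; apply: comput_uncons; [comput_base | comput_base | comput_var].
Qed.

Lemma comput_nth {G A} {EG : encoding G} {EA : encoding A}
    (d : A) (s : G -> seq A) (n : G -> nat) :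
  comput s -> comput n -> comput (fun x => nth d (s x) (n x)).
Proof.
move=> sP nP.
apply: (@eq_comput _ _ _ _ (fun x => head d (iter (n x) (fun t : seq A => if t is _ :: t' then t' else [::]) (s x)))).
  move=> x; elim: (n x) (s x) => [|n0 IH] t; first by case: t.
  by rewrite iterSr IH; case: t => //; rewrite nth_nil.
apply: comput_head; apply: comput_iter => //.
apply: (comput_uncons (l := fun q : G * seq A => q.2));
  [comput_base | comput_base | comput_var].
Qed.

Lemma comput_filter {G A} {EG : encoding G} {EA : encoding A}
    (p : G -> A -> bool) (s : G -> seq A) :
    comput s -> comput (fun q : G * A => p q.1 q.2) ->
  comput (fun x => [seq a <- s x | p x a]).
Proof.
move=> sP pP.
apply: (@eq_comput _ _ _ _ (fun x => foldr (fun a t => if p x a then a :: t else t) [::] (s x))).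
  by move=> x; elim: (s x) => //= a t ->.
apply: comput_foldr; [comput_base | comput_base |].
apply: comput_if; [|apply: comput_cons; comput_var | comput_var].
apply: (comput_app (h := fun q : G * A => p q.1 q.2)
  (f := fun q : G * (A * seq A) => (q.1, q.2.1))) => //.
by apply: comput_pair; comput_var.
Qed.

Lemma comput_map {G A B} {EG : encoding G} {EA : encoding A} {EB : encoding B}
    (f : G -> A -> B) (s : G -> seq A) :
    comput s -> comput (fun q : G * A => f q.1 q.2) ->
  comput (fun x => [seq f x a | a <- s x]).
Proof.
move=> sP fP.
apply: (@eq_comput _ _ _ _ (fun x => foldr (fun a t => f x a :: t) [::] (s x))).
  by move=> x; elim: (s x) => //= a t ->.
apply: comput_foldr; [comput_base | comput_base |].
apply: comput_cons; last comput_var.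
apply: (comput_app (h := fun q : G * A => f q.1 q.2)
  (f := fun q : G * (A * seq B) => (q.1, q.2.1))) => //.
by apply: comput_pair; comput_var.
Qed.

Lemma comput_mkseq {G A} {EG : encoding G} {EA : encoding A}
    (f : G -> nat -> A) (n : G -> nat) :
    comput n -> comput (fun q : G * nat => f q.1 q.2) ->
  comput (fun x => mkseq (f x) (n x)).
Proof.
move=> nP fP.
apply: (@eq_comput _ _ _ _ (fun x => nat_rect (fun _ => seq A) [::] (fun k r => rcons r (f x k)) (n x))).
  by move=> x; elim: (n x) => //= k ->; rewrite mkseqS.
apply: comput_rec; [comput_base | comput_base |].
apply: comput_rcons; first comput_var.
apply: (comput_app (h := fun q : G * nat => f q.1 q.2)
  (f := fun q : G * (nat * seq A) => (q.1, q.2.1))) => //.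
by apply: comput_pair; comput_var.
Qed.

Lemma comput_take {G A} {EG : encoding G} {EA : encoding A}
    (n : G -> nat) (s : G -> seq A) :
  comput s -> comput n -> comput (fun x => take (n x) (s x)).
Proof.
move=> sP nP.
apply: (@eq_comput _ _ _ _
  (fun x => foldl (fun t a => if size t < n x then rcons t a else t) [::] (s x))) => [x|].
  suff H (t u : seq A) : size t <= n x ->
      foldl (fun t a => if size t < n x then rcons t a else t) t u = t ++ take (n x - size t) u.
    by rewrite H // subn0.
  elim: u t => [|a u IH] t tn /=; first by rewrite cats0.
  case: ltnP => nt; last first.
    by rewrite IH // (_ : n x - size t = 0) ?take0 //; apply/eqP; rewrite subn_eq0.
  by rewrite IH size_rcons // cat_rcons -(subnSK nt).
apply: comput_foldl; [comput_base | comput_base |].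
apply: comput_if; [|apply: comput_rcons; comput_var | comput_var].
apply: comput_leq; first by apply/comput_succ/comput_size; comput_var.
by apply: (comput_app (h := n)); comput_base.
Qed.

Lemma comput_mem {G} {EG : encoding G} (f : G -> seq bool) (l : G -> seq (seq bool)) :
  comput f -> comput l -> comput (fun x => f x \in l x).
Proof.
move=> fP lP.
apply: (@eq_comput _ _ _ _ (fun x => foldr (fun a b => (f x == a) || b) false (l x))).
  by move=> x; elim: (l x) => //= a t ->.
apply: comput_foldr; [comput_base | comput_base |].
apply: comput_orb; last comput_var.
apply: (comput_eq (f := fun q : G * (seq bool * bool) => f q.1) (g := fun q => q.2.1)).
- by move=> x; apply: eqP.
- by apply: (comput_app (h := f)); comput_base.
comput_var.
Qed.

(** * Computability of the duplicated tree *)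

Lemma comput_bcode {G} {EG : encoding G} (w : G -> seq bool) :
  comput w -> comput (fun x => bcode (w x)).
Proof.
move=> wP; apply: comput_foldr; [comput_base | comput_base |].
apply: comput_add; last by apply: comput_nat_of_bool; comput_var.
by apply: comput_add; [apply: comput_double; comput_var | comput_base].
Qed.

Lemma comput_bdecode {G} {EG : encoding G} (k : G -> nat) :
  comput k -> comput (fun x => bdecode (k x)).
Proof.
move=> kP; apply: comput_fst.
apply: (comput_iter (A := (seq bool * nat)%type)) => //.
  by apply: comput_pair; comput_base.
apply: comput_natcase; [comput_var | comput_var |].
apply: comput_pair; last by apply: comput_half; comput_var.
by apply: comput_rcons; [|apply: comput_odd]; comput_var.
Qed.

Lemma comput_words {G} {EG : encoding G} (k : G -> nat) :
  comput k -> comput (fun x => words (k x)).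
Proof.
move=> kP.
apply: (@eq_comput _ _ _ _ (fun x => nat_rect (fun _ => seq (seq bool)) [:: [::]]
   (fun _ r => foldr (fun w t => [:: rcons w false, rcons w true & t]) [::] r) (k x))).
  by move=> x; elim: (k x) => // n /= ->; elim: (words n) => //= w t ->.
apply: comput_rec; [comput_base | comput_base |].
apply: comput_foldr; [comput_var | comput_base |].
by do 2![apply: comput_cons; first by apply: comput_rcons; comput_base]; comput_var.
Qed.

(** Vertices beyond the prefix count as absent; [eq_dup_tree] will keep this default out of the
    result. *)
Definition prefix_tree (s : seq nat) (w : seq bool) : bool := nth 0 s (bcode w) != 0.

Lemma comput_prefix_tree {G} {EG : encoding G} (s : G -> seq nat) (w : G -> seq bool) :
  comput s -> comput w ->
  comput (fun x => prefix_tree (s x) (w x)).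
Proof.
by move=> sP wP; apply: comput_neq0; apply: comput_nth => //; exact: comput_bcode.
Qed.

Lemma comput_level {G} {EG : encoding G} (s : G -> seq nat) (k : G -> nat) :
  comput s -> comput k ->
  comput (fun x => level (prefix_tree (s x)) (k x)).
Proof.
move=> sP kP; apply: comput_filter; first exact: comput_words.
apply: comput_prefix_tree; last comput_var.
by apply: (comput_app (h := s)); comput_base.
Qed.

Lemma comput_main_word {G} {EG : encoding G} k0 (w : G -> seq bool) (k : G -> nat) :
  comput w -> comput k ->
  comput (fun x => main_word k0 (w x) (k x)).
Proof.
move=> wP kP; apply: comput_mkseq => //.
have w1P : comput (fun q : G * nat => w q.1) by apply: (comput_app (h := w)); comput_base.
apply: comput_if; [|apply: comput_nth; comput_base|].
  by apply: comput_leq; [apply: comput_succ; comput_var | comput_base].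
have jP : comput (fun q : G * nat => q.2 - k0) by apply: comput_sub; comput_base.
apply: comput_if; [exact: comput_odd | comput_base |].
by apply: comput_nth => //; exact: comput_half.
Qed.

Lemma comput_leader {G} {EG : encoding G} k0 (s : G -> seq nat) (k : G -> nat) :
  comput s -> comput k ->
  comput (fun x => leader k0 (prefix_tree (s x)) (k x)).
Proof.
move=> sP kP; apply/comput_head/comput_level => //; apply: comput_succ.
by apply: comput_maxn; comput_base.
Qed.

Lemma comput_extra_word {G} {EG : encoding G} k0 (s : G -> seq nat) (k : G -> nat) :
  comput s -> comput k ->
  comput (fun x => extra_word k0 (prefix_tree (s x)) (k x)).
Proof.
move=> sP kP; pose T x := prefix_tree (s x).
apply: (@eq_comput _ _ _ _ (fun x => nat_rect (fun _ => seq bool)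
    (head [::] [seq w <- words k0 | ~~ T x w])
    (fun j r =>
      if odd j then
        if take j./2.+1 (leader k0 (T x) j./2) == take j./2.+1 (leader k0 (T x) j./2.+1)
        then rcons r false
        else rcons (main_word k0 (leader k0 (T x) j./2.+1) (k0 + j)) true
      else rcons r (nth false (leader k0 (T x) j./2) j./2)) (k x))).
  by move=> x; elim: (k x) => //= j ->.
apply: comput_rec => //.
  apply: comput_head; apply: comput_filter; first comput_base.
  apply/comput_negb/comput_prefix_tree; last comput_var.
  by apply: (comput_app (h := s)); comput_base.
pose GG := (G * (nat * seq bool))%type.
have s1P : comput (fun q : GG => s q.1) by apply: (comput_app (h := s)); comput_base.
have rP : comput (fun q : GG => q.2.2) by comput_var.
have jP : comput (fun q : GG => q.2.1) by comput_var.
have hP := comput_half jP; have hSP := comput_succ hP.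
have lP := comput_leader k0 s1P hP; have lSP := comput_leader k0 s1P hSP.
apply: comput_if; first exact: comput_odd.
  apply: comput_if; [|by apply: comput_rcons; comput_base|].
    apply: (comput_eq (fun x => eqP)); exact: comput_take.
  apply: comput_rcons; last comput_base.
  by apply: comput_main_word => //; apply: comput_add; comput_base.
by apply: comput_rcons => //; exact: comput_nth.
Qed.

Lemma comput_dup_tree {G} {EG : encoding G} k0 (s : G -> seq nat) (w : G -> seq bool) :
  comput s -> comput w ->
  comput (fun x => dup_tree k0 (prefix_tree (s x)) (w x)).
Proof.
move=> sP wP; have szP := comput_size wP.
apply: comput_orb.
  by apply: comput_leq; [exact: comput_succ | comput_base].
have jP : comput (fun x => size (w x) - k0) by apply: comput_sub; comput_base.
apply: comput_mem => //; apply: comput_cons; first exact: comput_extra_word.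
apply: comput_map.
  apply: comput_level => //; apply: comput_maxn; first comput_base.
  exact: comput_uphalf.
apply: comput_main_word; first comput_var.
by apply: (comput_app (h := fun x => size (w x))); comput_base.
Qed.

(** * From functions of finite prefixes to Type-2 machines *)

Definition out_size (c : nat) : nat -> nat :=
  nat_rect (fun _ => nat) 0 (fun m g => if 2 ^ (g + c) <= m.+1 then g.+1 else g).

Lemma out_size_leq c m i : i < out_size c m -> 2 ^ (i + c) <= m.
Proof.
elim: m => //= m IH; case: ifP => [Hm|_ /IH/leqW //].
by rewrite ltnS leq_eqVlt => /predU1P[->|/IH/leqW].
Qed.

Lemma out_size_mono c m n : m <= n -> out_size c m <= out_size c n.
Proof.
move=> /subnK <-; elim: (n - m) => //= k IH; case: ifP => // _; exact: leqW.
Qed.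

Lemma out_size_unbounded c i : exists m, i < out_size c m.
Proof.
elim: i => [|i [m im]].
  exists (2 ^ c).+1; rewrite /=; case: ifP => //; case: (out_size _ _) => //.
  by rewrite leqW.
pose M := maxn m (2 ^ (i.+1 + c)).
have iM : i < out_size c M by apply: leq_trans im (out_size_mono _ (leq_maxl _ _)).
exists M.+1 => /=; case: ifP => // H; rewrite leq_eqVlt in iM.
case/predU1P: iM => // E; move: H; rewrite -E => /negP[].
by apply: leqW; exact: leq_maxr.
Qed.

(** The machine writes digit [i] only once [2 ^ (i + c)] input digits are available; [out_size]
    counts the digits permitted so far. Exponential growth accommodates the codes of words of length
    about [i]. *)
Lemma computable_pfun_prefix c (D : baire -> Prop) (phi : seq nat -> nat -> nat) :
    comput (fun q : seq nat * nat => phi q.1 q.2) ->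
    (forall u v i, prefix u v -> 2 ^ (i + c) <= size u -> phi u i = phi v i) ->
  computable_pfun (PFun D (fun p i => phi (mkseq p (2 ^ (i + c))) i)).
Proof.
move=> phiP phi_pre; pose h s := mkseq (phi s) (out_size c (size s)).
have hP : comput h.
  apply: comput_mkseq => //.
  apply: comput_rec; [by apply: comput_size; comput_var | comput_base |].
  apply: comput_if; [|apply: comput_succ; comput_var | comput_var].
  apply: comput_leq; last by apply: comput_succ; comput_var.
  by apply: comput_pow2; apply: comput_add; comput_base.
exists h; split.
- have [d dP] := hP; exists d => n.
  have E (s : seq nat) : enc s = CodeSeq.code s by elim: s => //= a s ->.
  by have := dP (CodeSeq.decode n); rewrite !E CodeSeq.decodeK.
- move=> u v uv; have suv : size u <= size v by case/prefixP: uv => s ->;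
  rewrite size_cat leq_addr.
  have <- : mkseq (phi v) (out_size c (size u)) = h u.
    apply/eq_in_map => i; rewrite mem_iota => /andP[_ /out_size_leq iu].
    by rewrite (phi_pre u v).
  exact: prefix_mkseq (out_size_mono _ _).
move=> p _ n; have [m nm] := out_size_unbounded c n.
exists m; rewrite size_mkseq size_mkseq; split=> //.
rewrite nth_mkseq ?size_mkseq //; apply: esym; apply: phi_pre; last by rewrite size_mkseq.
exact/prefix_mkseq/out_size_leq.
Qed.

(** * C_{#n} reduces to C_{#n+1} *)

Definition dup_char k0 (s : seq nat) (i : nat) : nat :=
  dup_tree k0 (prefix_tree s) (bdecode i).

Definition dup_pfun k0 : pfun :=
  PFun (fun _ => True) (fun p i => dup_char k0 (mkseq p (2 ^ (i + 2))) i).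

(** Origin of the 2 in [dup_pfun]: one for the look-ahead of the tree, one for the exponent in
    [bcode_lt]. *)
Lemma bcode_lt_bdecode i v : size v <= (size (bdecode i)).+1 -> bcode v < 2 ^ (i + 2).
Proof.
move=> sv; apply: ltn_trans (ltnSn _) (leq_trans (bcode_lt v) _).
by rewrite leq_pexp2l //; have := size_bdecode i; lia.
Qed.

Lemma computable_dup_pfun k0 : computable_pfun (dup_pfun k0).
Proof.
apply: computable_pfun_prefix => [|u v i uv iu].
  by apply: comput_nat_of_bool; apply: comput_dup_tree; last apply: comput_bdecode; comput_var.
congr nat_of_bool; apply: eq_dup_tree => w /bcode_lt_bdecode wi.
by rewrite /prefix_tree (prefix_nth uv) // (leq_trans wi).
Qed.

Lemma tree_of_dup_pfun k0 p : tree_of (pval (dup_pfun k0) p) = dup_tree k0 (tree_of p).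
Proof.
apply: functional_extensionality => w; rewrite /tree_of /= /dup_char.
have -> : dup_tree k0 (prefix_tree (mkseq p (2 ^ (bcode w + 2)))) (bdecode (bcode w))
        = dup_tree k0 (tree_of p) w.
  rewrite -[w in RHS]bdecodeK; apply: eq_dup_tree => v /bcode_lt_bdecode vi.
  by rewrite /prefix_tree nth_mkseq.
by case: dup_tree.
Qed.

(* The answer of the oracle sits at the odd positions of its input. *)
Definition read_bit k0 (s : seq nat) (i : nat) : nat := nth 0 s (k0 + i.*2).*2.+1.

Definition read_pfun k0 : pfun :=
  PFun (fun _ => True) (fun p i => read_bit k0 (mkseq p (2 ^ (i + (k0 + 3)))) i).

Lemma read_pos_lt k0 i : (k0 + i.*2).*2.+1 < 2 ^ (i + (k0 + 3)).
Proof.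
have : i + k0 < 2 ^ (i + k0) by exact: ltn_expl.
by rewrite addnA [2 ^ (_ + 3)]expnD; lia.
Qed.

Lemma computable_read_pfun k0 : computable_pfun (read_pfun k0).
Proof.
apply: computable_pfun_prefix => [|u v i uv iu].
  apply: comput_nth; first comput_var.
  apply/comput_succ/comput_double/comput_add; first comput_base.
  by apply: comput_double; comput_var.
by rewrite /read_bit (prefix_nth uv) // (leq_trans (read_pos_lt k0 i)).
Qed.

Lemma read_pfun_bpair k0 p q i : pval (read_pfun k0) (bpair p q) i = q (k0 + i.*2).
Proof.
rewrite /= /read_bit nth_mkseq ?read_pos_lt // /bpair /= odd_double /=.
by rewrite uphalf_double.
Qed.

Lemma Weihrauch_le_C_sharpS n : 0 < n -> Weihrauch_le (C_sharp n) (C_sharp n.+1).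
Proof.
move=> n0; pose k0 := up_log 2 n.+1.
exists (read_pfun k0), (dup_pfun k0); split;
  [exact: computable_read_pfun | exact: computable_dup_pfun |].
move=> G GP p T /names_treeE -> [x [shT _]].
set q := pval (dup_pfun k0) p;
  have qE : tree_of q = dup_tree k0 (tree_of p) := tree_of_dup_pfun k0 p.
have [treeT cT [d chT]] := shT.
have nk : n < 2 ^ k0 by exact: up_logP.
have k0_min k : n.+1 <= 2 ^ k -> k0 <= k by exact: up_log_min.
have shq : sharp_tree n.+1 (tree_of q).
  by rewrite qE; exact: sharp_dup_tree n0 nk k0_min treeT cT chT.
have [y yq] := sharp_tree_path (ltn0Sn n) shq.
have [Gq [y' [Gy' [_ y'q]]]]
  := GP q (tree_of q) (fun w => erefl) (ex_intro _ y (conj shq yq)).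
split=> //=; exists (fun i => y' (k0 + i.*2)); split; last split=> //.
  by move=> i; rewrite [LHS]read_pfun_bpair Gy'.
by apply: (dup_tree_path n0 nk treeT cT); rewrite -qE.
Qed.

Theorem theorem37 : forall n : nat, 1 <= n ->
  Weihrauch_le (C_sharp n) (C_sharp n.+1) /\
  ~ Weihrauch_le (C_sharp n.+1) (C_sharp n).
Proof.
by move=> n n1; split; [exact: Weihrauch_le_C_sharpS | exact: not_Weihrauch_le_C_sharpS].
Qed.
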